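(* Let $G$ be a finite simple graph with vertex set $V(G)=\{t_1,\ldots,t_s\}$, let $S=K[t_1,\ldots,t_s]$ be a polynomial ring over a field $K$, and let $I(G)\subset S$ be the edge ideal of $G$. If $G$ is bipartite and $S/I(G)$ is sequentially Cohen--Macaulay, then $$\mathrm{v}(I(G))\leq\mathrm{reg}(S/I(G)).$$
   Context: The edge ideal $I(G)$ is the ideal of $S$ generated by all $t_it_j$ with $\{t_i,t_j\}\in E(G)$. A finitely generated graded $S$-module $M$ is sequentially Cohen--Macaulay if there is a finite filtration $0=M_0\subset M_1\subset\cdots\subset M_r=M$ by graded submodules such that each $M_i/M_{i-1}$ is Cohen--Macaulay and $\dim(M_1/M_0)<\dim(M_2/M_1)<\cdots<\dim(M_r/M_{r-1})$. With the standard grading $S=\bigoplus_{d\ge0}S_d$, for a proper squarefree monomial ideal $I\subset S$ the v-number is $\mathrm{v}(I)=\min\{d\geq 0\mid \exists f\in S_d\text{ and }\mathfrak{p}\in\mathrm{Ass}(I)\text{ with }(I\colon f)=\mathfrak{p}\}$, where $\mathrm{Ass}(I)$ is the set of associated primes of $S/I$ and $(I\colon f)=\{g\in S\mid gf\in I\}$; in particular $\mathrm{v}(I)=0$ if $I$ is prime. The regularity of $S/I$ is $\mathrm{reg}(S/I)=\max\{j-i\mid b_{i,j}\neq0\}$, where $b_{i,j}$ are the graded Betti numbers of the minimal graded free resolution of $S/I$ over $S$. *)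

(* Defs.v *)
From mathcomp Require Import all_boot all_order all_algebra.
From mathcomp Require Import mpoly.

Set Implicit Arguments.
Unset Strict Implicit.
Unset Printing Implicit Defensive.

Import GRing.Theory.
Local Open Scope ring_scope.

Section Ideals.
Variables (K : fieldType) (n : nat).
Local Notation S := {mpoly K[n]}.
Implicit Types (I J M N : S -> Prop) (f g x : S).

Definition is_ideal I :=
  [/\ I 0, forall f g, I f -> I g -> I (f + g) & forall f g, I g -> I (f * g)].

Definition ideal_le I J := forall f, I f -> J f.
Definition ideal_eq I J := forall f, I f <-> J f.
Definition ideal_lt I J := ideal_le I J /\ exists f, J f /\ ~ I f.

Definition is_prime_ideal (p : S -> Prop) :=
  [/\ is_ideal p, ~ p 1 & forall f g, p (f * g) -> p f \/ p g].

Definition ideal_gen (A : S -> Prop) : S -> Prop := fun f =>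
  exists m (c a : 'I_m -> S), (forall i, A (a i)) /\ f = \sum_i c i * a i.

Definition homogeneous_ideal I :=
  is_ideal I /\ forall f d, I f -> I (pihomog mdeg d f).

(* The maximal homogeneous ideal (t_1, ..., t_n). *)
Definition irrelevant : S -> Prop := fun f => f@_0%MM = 0.

Definition colon I f : S -> Prop := fun g => I (g * f).

(* Associated primes of S/I; (I : f) is the annihilator of the class of f. *)
Definition associated_prime I (p : S -> Prop) :=
  is_prime_ideal p /\ exists f, ideal_eq (colon I f) p.

Definition v_witness I (d : nat) :=
  exists f (p : S -> Prop), [/\ f \is d.-homog, associated_prime I p & ideal_eq (colon I f) p].

Definition is_v_number I (v : nat) :=
  v_witness I v /\ forall d, v_witness I d -> (v <= d)%N.

(* In the sequel a module is given by ideals N <= M of S and stands for the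
   subquotient M/N of S.  The graded submodules of S/I are the J/I with J a
   homogeneous ideal containing I, and (J/I)/(J'/I) = J/J'. *)

Definition annihilator M N : S -> Prop := fun f => forall g, M g -> N (f * g).

Definition prime_chain I (d : nat) (p : nat -> S -> Prop) :=
  [/\ forall i, (i <= d)%N -> is_prime_ideal (p i),
      forall i, (i <= d)%N -> ideal_le I (p i) &
      forall i, (i < d)%N -> ideal_lt (p i) (p i.+1)].

(* dim (M/N) = d, as the Krull dimension of S/Ann(M/N).  No d qualifies for
   the zero module. *)
Definition is_dim M N (d : nat) :=
  (exists p : nat -> S -> Prop, prime_chain (annihilator M N) d p) /\
  forall e, (exists p : nat -> S -> Prop, prime_chain (annihilator M N) e p) -> (e <= d)%N.

(* N + xM, so that M/(N + xM) = (M/N)/x(M/N). *)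
Definition add_multiples N x M : S -> Prop := fun f =>
  exists g h, [/\ N g, M h & f = g + x * h].

(* xs is a regular sequence on M/N; the base case is (M/N)/(xs)(M/N) != 0. *)
Fixpoint regular_seq M N (xs : seq S) : Prop :=
  if xs is x :: xs' then
    (forall g, M g -> N (x * g) -> N g) /\
    regular_seq M (add_multiples N x M) xs'
  else exists g, M g /\ ~ N g.

Definition homogeneous_regular_seq M N (xs : seq S) :=
  (forall x, x \in xs -> (exists d, x \is d.-homog) /\ irrelevant x) /\
  regular_seq M N xs.

Definition is_depth M N (d : nat) :=
  (exists xs, homogeneous_regular_seq M N xs /\ size xs = d) /\
  forall xs, homogeneous_regular_seq M N xs -> (size xs <= d)%N.

(* Cohen-Macaulayness of a nonzero M/N. *)
Definition cohen_macaulay M N := exists d, is_depth M N d /\ is_dim M N d.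

(* S/I is sequentially Cohen-Macaulay; J i / I is the i-th filtration step. *)
Definition sequentially_CM I :=
  exists (r : nat) (J : nat -> S -> Prop) (d : nat -> nat),
    [/\ ideal_eq (J 0) I /\ (forall f, J r f),
        forall i, (i <= r)%N -> homogeneous_ideal (J i),
        forall i, (i < r)%N -> ideal_lt (J i) (J i.+1),
        forall i, (i < r)%N ->
          cohen_macaulay (J i.+1) (J i) /\ is_dim (J i.+1) (J i) (d i) &
        forall i, (i.+1 < r)%N -> (d i < d i.+1)%N].

Definition homog_of_degree (a : int) f : Prop :=
  if a is Posz d then f \is d.-homog else f = 0.

(* A graded free resolution ... -> F_1 -> F_0 -> S/I -> 0, where F_i is the
   free module of row vectors of length fr_rank i, its k-th basis vector has
   degree fr_deg i k, and maps act by right multiplication.  The k-th basis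
   vector of F_0 is sent to the class of fr_aug k 0 modulo I. *)
Record graded_free_resolution I := GradedFreeResolution {
  fr_rank : nat -> nat;
  fr_deg : forall i, 'I_(fr_rank i) -> int;
  fr_aug : 'cV[S]_(fr_rank 0);
  fr_diff : forall i, 'M[S]_(fr_rank i.+1, fr_rank i);
  fr_aug_homog : forall k, homog_of_degree (fr_deg k) (fr_aug k 0);
  fr_diff_homog : forall i k l,
    homog_of_degree (@fr_deg i.+1 k - @fr_deg i l) (fr_diff i k l);
  fr_aug_surj : forall f, exists u : 'rV_(fr_rank 0),
    I (f - (u *m fr_aug) 0 0);
  fr_exact0 : forall u : 'rV_(fr_rank 0),
    I ((u *m fr_aug) 0 0) <-> exists w, u = w *m fr_diff 0;
  fr_exact : forall i (u : 'rV_(fr_rank i.+1)),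
    u *m fr_diff i = 0 <-> exists w, u = w *m fr_diff i.+1
}.

Definition minimal_resolution I (F : graded_free_resolution I) :=
  forall i k l, irrelevant (fr_diff F i k l).

Definition betti I (F : graded_free_resolution I) (i : nat) (j : int) : nat :=
  #|[set k | @fr_deg _ F i k == j]|.

(* reg (S/I) = r, computed on a minimal graded free resolution. *)
Definition is_regularity I (r : int) :=
  exists F : graded_free_resolution I,
    [/\ minimal_resolution F,
        exists (i : nat) (j : int), betti F i j != 0%N /\ r = j - i%:Z &
        forall (i : nat) (j : int), betti F i j != 0%N -> j - i%:Z <= r].

End Ideals.

(* A finite simple graph on the variables of K[t_1, ..., t_n] is a symmetric
   irreflexive relation e on 'I_n. *)

Definition bipartite n (e : rel 'I_n) :=
  exists c : 'I_n -> bool, forall i j, e i j -> c i != c j.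

Definition edge_ideal (K : fieldType) n (e : rel 'I_n) : {mpoly K[n]} -> Prop :=
  ideal_gen (fun f => exists i j, e i j /\ f = 'X_i * 'X_j).
Arguments edge_ideal K {n} e.

(* Main.v *)
(* A sequentially Cohen-Macaulay bipartite graph G has the following property:
   for every independent set A, the graph G - N[A] has no edge or has a leaf.
   Otherwise let V1, V2 be the colour classes of its non-isolated part, with
   |V1| <= |V2|.  The face A + V1 of the independence complex meets the other
   faces containing A in codimension at least two, whereas a suitable step J of
   the filtration lies in the primes of A + V1 and of A + V2 and S/J is an
   iterated extension of Cohen-Macaulay modules of dimension at least |A| + |V1|;
   vanishing of Ext^1(-, S/J) on modules of dimension at most |A| + |V1| - 2
   (Ischebeck) is violated by the homomorphism that is multiplication by t_A on
   one side and 0 on the other.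

   Choosing leaves x_k with neighbours y_k greedily, A := {y_1, ..., y_m} is
   independent, N(A) is a vertex cover and the x_k y_k form an induced matching.
   Then (I : t_A) = (N(A)) is prime, so v <= m, while the Koszul cycle
   x_1 e_(y_1) /\ ... /\ x_m e_(y_m) is not a boundary modulo I, so m <= reg. *)
Require Import Defs.
From mathcomp Require Import all_boot all_order all_algebra.
From mathcomp Require Import mpoly ring zify.
From Stdlib Require Import Classical_Prop ClassicalEpsilon.

Set Implicit Arguments.
Unset Strict Implicit.
Unset Printing Implicit Defensive.

Import Order.TTheory GRing.Theory Num.Theory.
Local Open Scope ring_scope.

(** * Vanishing of the first extension module *)

Section Ext.
Variables (K : fieldType) (n : nat).
Local Notation S := {mpoly K[n]}.
Implicit Types (I J M N : S -> Prop) (f g x : S).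

Lemma mcoeff_pihomog d f m :
  (pihomog mdeg d f)@_m = if mdeg m == d then f@_m else 0.
Proof.
have Ef := mpolyE f; rewrite pihomogE raddf_sum /= big_mkcond /=.
have -> : f@_m = \sum_(k <- msupp f) (f@_k *: 'X_[k] : S)@_m.
  by rewrite {1}Ef raddf_sum.
have [<-|ne] := eqVneq (mdeg m) d; last first.
  rewrite big1 // => k _; case: eqP => // hk.
  by rewrite mcoeffZ mcoeffX; case: eqP => [E|_]; rewrite ?mulr0 //; rewrite -hk E eqxx in ne.
apply: eq_bigr => k _; case: eqP => // hk.
by rewrite mcoeffZ mcoeffX; case: eqP => [E|_]; rewrite ?mulr0 //; case: hk; rewrite E.
Qed.

Lemma pihomog_partition f k :
  (msize f <= k)%N -> f = \sum_(d < k) pihomog mdeg d f.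
Proof. by move=> h; apply: pihomog_partitionE; rewrite mmeasureE -msizeE. Qed.

Lemma pihomogM_homog d e g f : g \is e.-homog ->
  pihomog mdeg d (g * f) = if (e <= d)%N then g * pihomog mdeg (d - e) f else 0.
Proof.
move=> hg; pose k := (msize f + d).+1.
rewrite [in LHS](@pihomog_partition f k); last by rewrite /k; lia.
rewrite mulr_sumr linear_sum /=.
have E (j : 'I_k) : pihomog mdeg d (g * pihomog mdeg j f) =
    if (e + j == d)%N then g * pihomog mdeg j f else 0.
  have H : g * pihomog mdeg j f \is (e + j).-homog by apply: dhomogM => //; exact: pihomogP.
  case: eqP => [<-|/eqP ne]; first exact: pihomog_dE.
  by rewrite (pihomog_ne0 ne).
rewrite (eq_bigr _ (fun j _ => E j)); case: ifP => hed; last first.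
  by rewrite big1 // => j _; case: eqP => // ?; lia.
have hlt : (d - e < k)%N by rewrite /k; lia.
rewrite (bigD1 (Ordinal hlt)) //= subnKC // eqxx big1 ?addr0 // => j hj.
case: eqP => // Ej; case/eqP: hj; apply: val_inj => /=; lia.
Qed.

Lemma mcoeffM0 f g m :
  (forall k1 k2, m = (k1 + k2)%MM -> f@_k1 * g@_k2 = 0) -> (f * g)@_m = 0.
Proof. by move=> h; rewrite mcoeffM big1 // => k /eqP /h. Qed.

Lemma mcoeff_irrelevant_pow x j f m :
  irrelevant x -> (mdeg m < j)%N -> (x ^+ j * f)@_m = 0.
Proof.
move=> ix; elim: j m => [|j IH] m hm //.
rewrite exprS -mulrA; apply: mcoeffM0 => k1 k2 Em.
have [E|E] := eqVneq k1 0%MM; first by rewrite E ix mul0r.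
rewrite IH ?mulr0 //; rewrite Em mdegD in hm.
by move: E; rewrite -mdeg_eq0; lia.
Qed.

Section IdealOps.
Variable I : S -> Prop.
Hypothesis hI : is_ideal I.
Lemma ideal0 : I 0. Proof. by case: hI. Qed.
Lemma idealD f g : I f -> I g -> I (f + g). Proof. by case: hI => _ + _; apply. Qed.
Lemma idealMl f g : I g -> I (f * g). Proof. by case: hI => _ _; apply. Qed.
Lemma idealN f : I f -> I (- f). Proof. by rewrite -mulN1r; apply: idealMl. Qed.
Lemma idealB f g : I f -> I g -> I (f - g). Proof. by move=> hf hg; apply: idealD => //; apply: idealN. Qed.
Lemma idealZ (c : K) f : I f -> I (c *: f). Proof. by rewrite -mul_mpolyC; apply: idealMl. Qed.
Lemma ideal_sum (T : Type) (r : seq T) (P : pred T) (F : T -> S) :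
  (forall i, P i -> I (F i)) -> I (\sum_(i <- r | P i) F i).
Proof. by move=> h; apply: big_ind => //; [exact: ideal0 | exact: idealD]. Qed.
End IdealOps.

Lemma add_multiples_homog M N x d : homogeneous_ideal M -> homogeneous_ideal N ->
  x \is d.-homog -> homogeneous_ideal (add_multiples N x M).
Proof.
move=> [iM hM] [iN hN] hx; split.
  split.
  - exists 0, 0; split; [exact: ideal0|exact: ideal0|by ring].
  - move=> _ _ [a [b [ha hb ->]]] [a' [b' [ha' hb' ->]]].
    exists (a + a'), (b + b'); split; [exact: idealD|exact: idealD|by ring].
  - move=> c _ [a [b [ha hb ->]]].
    exists (c * a), (c * b); split; [exact: idealMl|exact: idealMl|by ring].
move=> _ k [a [b [ha hb ->]]]; rewrite linearD /= (pihomogM_homog _ _ hx).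
case: ifP => _.
  by exists (pihomog mdeg k a), (pihomog mdeg (k - d) b); split; [exact: hN|exact: hM|].
exists (pihomog mdeg k a), 0; split; [exact: hN|exact: ideal0|by ring].
Qed.

Lemma add_multiplesl M N x f : is_ideal M -> N f -> add_multiples N x M f.
Proof. by move=> iM hf; exists f, 0; split=> //; [exact: ideal0 | ring]. Qed.

Lemma add_multiplesr M N x f : is_ideal N -> M f -> add_multiples N x M (x * f).
Proof. by move=> iN hf; exists 0, f; split=> //; [exact: ideal0 | ring]. Qed.

(** Krull's intersection theorem in graded form: in degree [d] the equation for [j = d.+1] shows
    only a component of [g], because [x ^+ d.+1 * h] has no term of degree at most [d]. *)
Lemma adic_closed N x f : homogeneous_ideal N -> irrelevant x ->
  (forall j, exists g h, N g /\ f = g + x ^+ j * h) -> N f.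
Proof.
move=> [iN hN] ix H.
rewrite (pihomog_partition (leqnn (msize f))).
apply: (ideal_sum iN) => d _; have [g [h [hg E]]] := H d.+1.
suff -> : pihomog mdeg d f = pihomog mdeg d g by exact: hN.
rewrite [X in pihomog _ _ X]E linearD /=; suff -> : pihomog mdeg d (x ^+ d.+1 * h) = 0 by rewrite addr0.
apply/mpolyP => m; rewrite mcoeff_pihomog mcoeff0; case: eqP => // Em.
by rewrite mcoeff_irrelevant_pow // Em.
Qed.

(** * Dimension through the growth of the Hilbert function *)

Definition degree_le (T : nat) f := forall m, (T < mdeg m)%N -> f@_m = 0.

Lemma degree_leM T1 T2 f g :
  degree_le T1 f -> degree_le T2 g -> degree_le (T1 + T2) (f * g).
Proof.
move=> hf hg m hm; apply: mcoeffM0 => k1 k2 Em; rewrite Em mdegD in hm.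
have [h|h] := ltnP T1 (mdeg k1); first by rewrite hf ?mul0r.
by rewrite hg ?mulr0 //; lia.
Qed.

Lemma degree_leX T f j : degree_le T f -> degree_le (j * T) (f ^+ j).
Proof.
move=> hf; elim: j => [|j IH].
  by move=> m hm; rewrite expr0 mcoeff1 -mdeg_eq0; case: eqP => // ?; lia.
by rewrite exprS mulSn; apply: degree_leM.
Qed.

Lemma degree_leW T1 T2 f : (T1 <= T2)%N -> degree_le T1 f -> degree_le T2 f.
Proof. by move=> h hf m hm; apply: hf; lia. Qed.

Lemma degree_le_msize f : degree_le (msize f) f.
Proof. by move=> m hm; apply: memN_msupp_eq0; apply: msize_mdeg_ge; lia. Qed.

(* [growth_lt e I] bounds the Hilbert function of [S/I] by [O(T^(e-1))]: it
   says that [dim (S/I) < e].  The factor [T.+1] on the left makes this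
   meaningful for [e = 0]. *)
Definition growth_lt (e : nat) I := exists C : nat,
  forall (T : nat) (L : finType) (y : L -> S), (forall i, degree_le T (y i)) ->
  (forall c : L -> K, I (\sum_i c i *: y i) -> forall i, c i = 0) ->
  (#|L| * T.+1 <= C * T.+1 ^ e)%N.

(** For [e = 0] the bound reads [#|L| * T.+1 <= C] for every [T]; the one-element family [1] would
    violate it at [T = C]. *)
Lemma growth_lt0 I : is_ideal I -> growth_lt 0 I -> I 1.
Proof.
move=> iI [C HC]; apply: NNPP => nI1.
have := HC C unit (fun=> 1); rewrite card_unit expn0 => H.
suff : (1 * C.+1 <= C * 1)%N by lia.
apply: H.
  by move=> _ m hm; rewrite mcoeff1 -mdeg_eq0; case: eqP => // ?; lia.
have Eu (F : unit -> S) : \sum_i F i = F tt by rewrite (bigD1 tt) //= big1 ?addr0 //; case.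
move=> c; rewrite Eu => hc []; apply/eqP/negPn/negP => c0.
apply: nI1; rewrite (_ : 1 = (c tt)^-1 *: (c tt *: 1 : S)); first exact: (idealZ iI).
by rewrite scalerA mulVf // scale1r.
Qed.

Definition saturation I x : S -> Prop := fun f => exists j, I (x ^+ j * f).
Local Notation total := (fun _ : S => True).

Lemma total_homog : homogeneous_ideal total. Proof. by []. Qed.

Lemma saturation_homog I x d : homogeneous_ideal I -> x \is d.-homog ->
  homogeneous_ideal (saturation I x).
Proof.
move=> [iI hI] hx; split.
  split; first by exists 0%N; rewrite mulr0; exact: ideal0.
    move=> f g [i hi] [j hj]; exists (i + j)%N.
    rewrite (_ : _ * _ = x ^+ j * (x ^+ i * f) + x ^+ i * (x ^+ j * g)); last by rewrite exprD; ring.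
    by apply: idealD => //; apply: idealMl.
  by move=> f g [j hj]; exists j; rewrite mulrCA; apply: idealMl.
move=> f k [j hj]; exists j; have := hI _ (d * j + k)%N hj.
by rewrite (pihomogM_homog _ _ (dhomogMn j hx)) leq_addr addKn.
Qed.

Lemma saturationl I x f : I f -> saturation I x f.
Proof. by move=> h; exists 0%N; rewrite expr0 mul1r. Qed.

(** Saturating first makes [x] a nonzerodivisor, so that cutting by [x] lowers the dimension: a
    family [y i] independent modulo the new ideal yields the [T.+1] times larger family
    [x ^+ j * y i], [j <= T], independent modulo [I]. *)
Lemma growth_lt_step e I x : is_ideal I -> growth_lt e.+1 I ->
  growth_lt e (add_multiples (saturation I x) x total).
Proof.
move=> iI [C HC]; pose D := msize x.
(* The products have degree at most [T * D + T], whose successor is at most [D.+1 * T.+1]; this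
   gives the constant. *)
exists (C * D.+1 ^ e)%N => T L y hy indep.
pose T' := (T * D + T)%N.
have := HC T' (L * 'I_T.+1)%type (fun p => x ^+ p.2 * y p.1).
rewrite card_prod card_ord => H.
suff : (#|L| * T.+1 * T'.+1 <= C * T'.+1 ^ e.+1)%N.
  rewrite expnSr mulnA leq_pmul2r // => le; apply: leq_trans le _.
  rewrite -mulnA leq_mul2l -expnMn; apply/orP; right.
  by have [->|e0] := posnP e; rewrite ?expn0 // leq_exp2r // /T'; lia.
apply: H.
  move=> [i j] /=; apply: (@degree_leW (j * D + T)).
    by rewrite /T' leq_add2r leq_mul2r -ltnS ltn_ord orbT.
  by apply: degree_leM => //; apply: degree_leX; exact: degree_le_msize.
move=> c hc.
pose z j := \sum_i c (i, j) *: y i.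
have Ec : \sum_p c p *: (x ^+ p.2 * y p.1) = \sum_j x ^+ (j : 'I_T.+1) * z j.
  pose F (i : L) (j : 'I_T.+1) := c (i, j) *: (x ^+ j * y i).
  rewrite (eq_bigr (fun p => F p.1 p.2)); last by case.
  rewrite -(pair_bigA _ F) /F /=.
  rewrite exchange_big /=; apply: eq_bigr => j _; rewrite mulr_sumr.
  by apply: eq_bigr => i _; rewrite scalerAr.
rewrite Ec in hc.
suff Z t : forall j : 'I_T.+1, (j < t)%N -> forall i, c (i, j) = 0.
  by move=> [i j]; apply: (Z T.+1).
(* Once the coefficients of index below [t] vanish, [x ^+ t] factors out of the relation, and the
   other factor is in the saturation. *)
elim: t => // t IH j hj i.
have [lt|ge] := ltnP j t; first exact: IH.
have jt : j = t :> nat by lia.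
move: i; apply: indep; rewrite -/(z j).
pose r := \sum_(k : 'I_T.+1 | (t < k)%N) x ^+ (k - t.+1) * z k.
have Er : \sum_(k : 'I_T.+1) x ^+ k * z k = x ^+ t * (z j + x * r).
  rewrite (bigID (fun k : 'I_T.+1 => (k < t)%N)) /= big1 ?add0r; last first.
    by move=> k hk; rewrite /z big1 ?mulr0 // => i _; rewrite IH ?scale0r.
  rewrite (bigD1 j) /=; last by rewrite jt ltnn.
  rewrite jt mulrDr; congr (_ + _); rewrite /r !mulr_sumr.
  apply: eq_big => [k|k hk]; first by rewrite -(inj_eq val_inj) /= jt; lia.
  have {1}-> : (k = t + (1 + (k - t.+1)) :> nat)%N.
    by move: hk; rewrite -(inj_eq val_inj) /= jt; lia.
  by rewrite !exprD expr1 !mulrA.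
exists (z j + x * r), (- r); split=> //; last by ring.
by exists t; rewrite -Er.
Qed.

Definition homogeneous_irrelevant x := (exists d, x \is d.-homog) /\ irrelevant x.

Lemma hregular_cons M N x xs : homogeneous_regular_seq M N (x :: xs) ->
  [/\ homogeneous_irrelevant x, forall g, M g -> N (x * g) -> N g &
     homogeneous_regular_seq M (add_multiples N x M) xs].
Proof.
move=> [h [h1 h2]]; split=> //; first by apply: h; rewrite mem_head.
by split=> // y hy; apply: h; rewrite inE hy orbT.
Qed.

Lemma regular_exp M N x : is_ideal M -> (forall g, M g -> N (x * g) -> N g) ->
  forall j g, M g -> N (x ^+ j * g) -> N g.
Proof.
move=> iM h; elim=> [|j IH] g hg; first by rewrite mul1r.
by rewrite exprS -mulrA => /h H; apply: IH => //; apply: H; apply: idealMl.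
Qed.

(** This is [Hom(S/I, M/N) = 0] for [dim (S/I) < e] and a regular sequence of length at least [e].
    An element killed by [I] is killed by the saturation, as [x] is regular, hence modulo [x] by the
    saturation plus [x]. Induction puts it in [N + xM], and repeated division by [x] puts it in
    every [N + x^j M]. *)
Lemma torsionfree e : forall M N I xs, homogeneous_ideal M -> homogeneous_ideal N ->
  homogeneous_ideal I -> homogeneous_regular_seq M N xs -> growth_lt e I ->
  (e <= size xs)%N -> forall m, M m -> (forall f, I f -> N (f * m)) -> N m.
Proof.
elim: e => [|e IH] M N I xs hM hN hI hxs gI hsz m Mm Im.
  by rewrite -[m]mul1r; apply: Im; apply: growth_lt0 => //; case: hI.
case: xs hxs hsz => // x xs /hregular_cons[[[d hx] ix] rx hxs] /= hsz.
have [iM iN iI] : [/\ is_ideal M, is_ideal N & is_ideal I] by case: hM hN hI => ? _ [? _] [].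
suff H j : forall m, M m -> (forall f, I f -> N (f * m)) -> add_multiples N (x ^+ j) M m.
  apply: (adic_closed hN ix) => j.
  by have [g [h [? _ ?]]] := H j m Mm Im; exists g, h.
elim: j {m Mm Im} => [|j IHj] m Mm Im.
  by exists 0, m; split=> //; [exact: ideal0 | rewrite add0r mul1r].
have [g [h [Ng Mh Em]]] : add_multiples N x M m.
  apply: (IH M _ (add_multiples (saturation I x) x total) xs) => //.
  - exact: (add_multiples_homog hM hN hx).
  - exact: (add_multiples_homog total_homog (saturation_homog hI hx) hx).
  - exact: growth_lt_step.
  move=> _ [a [b [[i ha] _ ->]]]; rewrite mulrDl -mulrA.
  apply: (idealD (proj1 (add_multiples_homog hM hN hx))).
    apply: add_multiplesl => //; apply: (regular_exp iM rx) (_ : N (x ^+ i * _)).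
      exact: idealMl.
    by rewrite mulrA; apply: Im.
  by apply: add_multiplesr => //; apply: idealMl.
have [g' [h' [Ng' Mh' Eh]]] : add_multiples N (x ^+ j) M h.
  apply: IHj => // f If; apply: rx; first exact: idealMl.
  rewrite (_ : _ * _ = f * m - f * g); last by rewrite Em; ring.
  by apply: idealB => //; [exact: Im | exact: idealMl].
exists (g + x * g'), h'; split=> //; first by apply: idealD => //; apply: idealMl.
by rewrite Em Eh exprS; ring.
Qed.

(** A substitute for prime avoidance: induction gives an element [b + x * s] regular modulo [x],
    with [b] in the saturation. The component [c] of [b] in the same degree agrees with it modulo
    [x], and [c] times a suitable power of [x] lies in [I] and is regular on [M/N] itself. *)
Lemma regular_element e : forall M N I xs, homogeneous_ideal M -> homogeneous_ideal N ->
  homogeneous_ideal I -> homogeneous_regular_seq M N xs -> growth_lt e I ->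
  (e <= size xs)%N -> exists a, [/\ I a, exists d, a \is d.-homog &
     forall g, M g -> N (a * g) -> N g].
Proof.
elim: e => [|e IH] M N I xs hM hN hI hxs gI hsz.
  exists 1; split; first by apply: growth_lt0 => //; case: hI.
    by exists 0%N; exact: dhomog1.
  by move=> g _; rewrite mul1r.
case: xs hxs hsz => // x xs /hregular_cons[[[d hx] ix] rx hxs] /= hsz.
have [iM iN iI] : [/\ is_ideal M, is_ideal N & is_ideal I] by case: hM hN hI => ? _ [? _] [].
have hsat := saturation_homog hI hx.
have [_ [[b [s [hb _ ->]]] [k hk] ra]] := IH M _ (add_multiples (saturation I x) x total) xs
   hM (add_multiples_homog hM hN hx)
  (add_multiples_homog total_homog hsat hx) hxs (growth_lt_step _ iI gI) hsz.
pose c := pihomog mdeg k b.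
have [j hj] : saturation I x c by apply: (proj2 hsat).
have Ec : exists t, b + x * s = c + x * t.
  have <- := pihomog_dE hk; rewrite linearD /= (pihomogM_homog _ _ hx).
  by case: ifP => _; [eexists | exists 0; rewrite mulr0].
have rc g : M g -> N (c * g) -> add_multiples N x M g.
  move=> Mg Ng; apply: ra => //; have [t ->] := Ec.
  by exists (c * g), (t * g); split=> //; [exact: idealMl | ring].
exists (x ^+ j * c); split=> //.
  by exists (d * j + k)%N; apply: dhomogM; [exact: dhomogMn | exact: pihomogP].
move=> g Mg; rewrite -mulrA => Ng.
have {}Ng : N (c * g) by apply: (regular_exp iM rx) Ng; exact: idealMl.
apply: (adic_closed hN ix) => i.
suff [? [h [? _ ?]]] : add_multiples N (x ^+ i) M g by eexists _, h; split; eauto.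
elim: i g Mg Ng => [|i IHi] g Mg Ng.
  by exists 0, g; split=> //; [exact: ideal0 | rewrite add0r mul1r].
have [u [h [Nu Mh Eg]]] := rc g Mg Ng.
have [u' [h' [Nu' Mh' Eh]]] : add_multiples N (x ^+ i) M h.
  apply: IHi => //; apply: rx; first exact: idealMl.
  rewrite (_ : _ * _ = c * g - c * u); last by rewrite Eg; ring.
  by apply: idealB => //; exact: idealMl.
exists (u + x * u'), h'; split=> //; first by apply: idealD => //; apply: idealMl.
by rewrite Eg Eh exprS; ring.
Qed.

(* A relation [U] relates [a] in [I] to its values [u a] in [M] under a
   homomorphism [u : I -> M/N]; [extension_vanishing] says that [u] is the
   multiplication by an element of [M], i.e. that [Ext^1(S/I, M/N) = 0]. *)
Definition partial_hom M N I (U : S -> S -> Prop) :=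
  [/\ forall a, I a -> exists m, U a m, forall a m, U a m -> I a /\ M m &
      forall a m b p, U a m -> U b p -> N (a * p - b * m)].

(** One more unit of depth than in [torsionfree] kills [Ext^1]. The induction replaces [N] by
    [N + xM] and [I] by its saturation plus [x]; the solutions modulo all powers of [x] are then
    combined through a homogeneous regular element [a0] of [I]. *)
Lemma extension_vanishing e : forall M N I xs U,
  homogeneous_ideal M -> homogeneous_ideal N ->
  homogeneous_ideal I -> homogeneous_regular_seq M N xs -> growth_lt e I ->
  (e < size xs)%N -> partial_hom M N I U ->
  exists z, M z /\ forall a m, U a m -> N (m - a * z).
Proof.
elim: e => [|e IH] M N I xs U hM hN hI hxs gI hsz.
  move=> [Uex Udom Uc].
  have I1 : I 1 by apply: growth_lt0 => //; case: hI.
  have [z Uz] := Uex _ I1; exists z; split; first by case: (Udom _ _ Uz).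
  by move=> a m Ua; have := Uc _ _ _ _ Uz Ua; rewrite mul1r.
have [a0 [Ia0 [d0 ha0] ra0]] := regular_element hM hN hI hxs gI (ltnW hsz).
case: xs hxs hsz => // x xs /hregular_cons[[[d hx] ix] rx hxs] /= hsz.
have [iM iN iI] : [/\ is_ideal M, is_ideal N & is_ideal I] by case: hM hN hI => ? _ [? _] [].
have hNx := add_multiples_homog hM hN hx.
have iNx : is_ideal (add_multiples N x M) by case: hNx.
have hsat := saturation_homog hI hx; have isat : is_ideal (saturation I x) by case: hsat.
(* This is [Hom(S/I, M/(N + x^j M)) = 0], obtained by peeling off one factor [x] at a time. *)
have divx j m : M m -> (forall a, I a -> add_multiples N (x ^+ j) M (a * m)) ->
    add_multiples N (x ^+ j) M m.
  elim: j m => [|j IHj] m Mm Hm.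
    by exists 0, m; split=> //; [exact: ideal0 | rewrite add0r mul1r].
  have [g [h [Ng Mh Em]]] : add_multiples N x M m.
    apply: (torsionfree hM hNx hI hxs gI hsz) => // f If.
    have [g [h [Ng Mh E]]] := Hm f If.
    exists g, (x ^+ j * h); split=> //; first exact: idealMl.
    by rewrite E exprS mulrA.
  have [g' [h' [Ng' Mh' Eh]]] : add_multiples N (x ^+ j) M h.
    apply: IHj => // f If; have [u [v [Nu Mv E]]] := Hm f If.
    exists (f * h - x ^+ j * v), v; split=> //; last by ring.
    apply: rx; first by apply: idealB => //; exact: idealMl.
    rewrite (_ : _ * _ = u - f * g); first by apply: idealB => //; exact: idealMl.
    have -> : u = f * m - x ^+ j.+1 * v by rewrite E; ring.
    by rewrite Em exprS; ring.
  exists (g + x * g'), h'; split=> //; first by apply: idealD => //; apply: idealMl.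
  by rewrite Em Eh exprS; ring.
(* [V] extends to the saturation as [Vs], sending [s] to [V (x^j s)] divided by [x^j]; [divx] makes
   the division possible. [W] is the induced map into [M/(N + xM)] that kills the multiples of [x],
   and the induction hypothesis applies to it. *)
have step V : partial_hom M N I V ->
    exists z, M z /\ forall a m, V a m -> add_multiples N x M (m - a * z).
  move=> [Vex Vdom Vc].
  pose Vs s m := M m /\ exists j p, [/\ I (x ^+ j * s), V (x ^+ j * s) p & N (x ^+ j * m - p)].
  have Vs_ex s : saturation I x s -> exists m, Vs s m.
    move=> [j hj]; have [p hp] := Vex _ hj; have [_ Mp] := Vdom _ _ hp.
    have [g [m [Ng Mm E]]] : add_multiples N (x ^+ j) M p.
      apply: divx => // a Ia; have [q hq] := Vex _ Ia; have [_ Mq] := Vdom _ _ hq.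
      exists (a * p - x ^+ j * s * q), (s * q); split; last by ring.
        exact: Vc hq hp.
      exact: idealMl.
    exists m; split=> //; exists j, p; split=> //.
    by rewrite E (_ : _ - _ = - g); [exact: idealN | ring].
  have Vs_c a m b p : Vs a m -> Vs b p -> N (a * p - b * m).
    move=> [Mm [i [m' [Ii Um Nm]]]] [Mp [j [p' [Ij Up Np]]]].
    apply: (regular_exp (j := (i + j)%N) iM rx); first by apply: idealB => //; exact: idealMl.
    rewrite (_ : _ * _ = (x ^+ i * a * p' - x ^+ j * b * m') +
       (x ^+ i * a * (x ^+ j * p - p') - x ^+ j * b * (x ^+ i * m - m'))); last by rewrite exprD; ring.
    by apply: idealD => //; [exact: Vc | apply: idealB => //; exact: idealMl].
  pose W f w := exists b s, [/\ f = b + x * s, saturation I x b & Vs b w].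
  have [z [Mz hz]] : exists z, M z /\ forall a m, W a m -> add_multiples N x M (m - a * z).
    apply: (IH M _ (add_multiples (saturation I x) x total) xs) => //.
    - exact: (add_multiples_homog total_homog hsat hx).
    - exact: growth_lt_step.
    split.
    - by move=> _ [b [s [hb _ ->]]]; have [w hw] := Vs_ex b hb; exists w, b, s.
    - by move=> _ w [b [s [-> hb [Mw hw]]]]; split=> //; exists b, s.
    move=> _ w _ w' [b [s [-> _ hw]]] [c [t [-> _ hw']]].
    rewrite (_ : _ - _ = (b * w' - c * w) + x * (s * w' - t * w)); last by ring.
    exists (b * w' - c * w), (s * w' - t * w); split=> //; first exact: Vs_c.
    by apply: idealB => //; apply: idealMl => //; [case: hw' | case: hw].
  exists z; split=> // a m Vam; have [Ia Mm] := Vdom _ _ Vam.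
  apply: hz; exists a, 0; split; [by rewrite mulr0 addr0 | exact: saturationl |].
  by split=> //; exists 0%N, m; rewrite !mul1r subrr; split=> //; exact: ideal0.
(* Successive approximation: the error left by [step] is divisible by [x], and its quotient by [x]
   is again a homomorphism. *)
have adic j V : partial_hom M N I V ->
    exists z, M z /\ forall a m, V a m -> add_multiples N (x ^+ j) M (m - a * z).
  elim: j V => [|j IHj] V hV.
    exists 0; split; first exact: ideal0.
    move=> a m Vam; have [_ Vdom _] := hV; have [_ Mm] := Vdom _ _ Vam.
    by exists 0, m; split=> //; [exact: ideal0 | ring].
  have [z [Mz hz]] := step V hV; have [Vex Vdom Vc] := hV.
  have [|t [Mt ht]] := IHj (fun a q => exists m, [/\ M q, V a m & N (m - a * z - x * q)]); last first.
    exists (z + x * t); split; first by apply: idealD => //; exact: idealMl.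
    move=> a m Vam; have [g [q [Ng Mq E]]] := hz a m Vam.
    have [|u [v [Nu Mv E']]] := ht a q.
      exists m; split=> //; rewrite E (_ : _ - _ = g) //; ring.
    exists (g + x * u), v; split=> //; first by apply: idealD => //; exact: idealMl.
    have -> : m - a * (z + x * t) = (m - a * z) - x * (a * t) by ring.
    have -> : m - a * z = g + x * ((q - a * t) + a * t) by rewrite E; ring.
    by rewrite E' exprS; ring.
  split.
  - move=> a Ia; have [m Vam] := Vex _ Ia; have [g [q [Ng Mq E]]] := hz a m Vam.
    exists q, m; split=> //; rewrite E (_ : _ - _ = g) //; ring.
  - by move=> a q [m [Mq Vam _]]; have [] := Vdom _ _ Vam.
  move=> a q b q' [m [Mq Vm Nm]] [m' [Mq' Vm' Nm']].
  apply: rx; first by apply: idealB => //; exact: idealMl.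
  rewrite (_ : _ * _ = (a * m' - b * m) -
    (a * (m' - b * z - x * q') - b * (m - a * z - x * q))); last by ring.
  by apply: idealB => //; [exact: Vc | apply: idealB => //; exact: idealMl].
move=> hU; have [Uex Udom Uc] := hU.
have [m0 Um0] := Uex _ Ia0; have [_ Mm0] := Udom _ _ Um0.
(* The [z] given by [adic] may vary with [j] and no limit is taken: [m0] lies in [N + a0 M + x^j M]
   for every [j], hence in [N + a0 M]. *)
have [g [z [Ng Mz Em0]]] : add_multiples N a0 M m0.
  apply: (adic_closed (add_multiples_homog hM hN ha0) ix) => j.
  have [z [Mz hz]] := adic j U hU; have [g [h [Ng Mh E]]] := hz _ _ Um0.
  exists (g + a0 * z), h; split; first by exists g, z.
  by rewrite (_ : m0 = (m0 - a0 * z) + a0 * z); [rewrite E; ring | ring].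
exists z; split=> // a m Uam; have [_ Mm] := Udom _ _ Uam.
apply: ra0; first by apply: idealB => //; exact: idealMl.
rewrite (_ : _ * _ = (a0 * m - a * m0) + a * g); last by rewrite Em0; ring.
by apply: idealD => //; [exact: Uc | exact: idealMl].
Qed.
End Ext.

(** * Squarefree monomial ideals and faces *)

Section SquarefreeIdeals.
Variables (K : fieldType) (n : nat).
Local Notation S := {mpoly K[n]}.
Implicit Types (m : 'X_{1..n}) (f g : S) (A B F : {set 'I_n}).

Definition mnm_set m : {set 'I_n} := [set i | m i != 0%N].

Definition set_mnm A : 'X_{1..n} := [multinom (i \in A : nat) | i < n].

Definition monomial_of A : S := 'X_[set_mnm A].

Lemma mnm_setD m1 m2 : mnm_set (m1 + m2) = mnm_set m1 :|: mnm_set m2.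
Proof. apply/setP => i; rewrite !inE mnmDE addn_eq0 negb_and. by []. Qed.

Lemma set_mnmK A : mnm_set (set_mnm A) = A.
Proof. by apply/setP => i; rewrite !inE mnmE; case: (i \in A). Qed.

Lemma mnm_setU i : mnm_set U_(i) = [set i].
Proof. by apply/setP => j; rewrite !inE mnm1E (eq_sym j); case: (i == j). Qed.

(** For upward closed [P] these are the squarefree monomial ideals; other [P] give linear subspaces
    that record the supports of factors in a product. *)
Definition supported_in (P : pred {set 'I_n}) : S -> Prop :=
  fun f => forall m, ~~ P (mnm_set m) -> f@_m = 0.

Definition upward_closed (P : pred {set 'I_n}) := forall A B, A \subset B -> P A -> P B.

Lemma supported_inM (P Q R : pred {set 'I_n}) f g :
  (forall A B, P A -> Q B -> R (A :|: B)) ->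
  supported_in P f -> supported_in Q g -> supported_in R (f * g).
Proof.
move=> h hf hg m hm; apply: mcoeffM0 => k1 k2 Em.
have [hP|/hf->] := boolP (P (mnm_set k1)); last by rewrite mul0r.
have [hQ|/hg->] := boolP (Q (mnm_set k2)); last by rewrite mulr0.
by move: hm; rewrite Em mnm_setD h.
Qed.

Lemma supported_in_homog P : upward_closed P -> homogeneous_ideal (supported_in P).
Proof.
move=> hP; split; last first.
  by move=> f d hf m hm; rewrite mcoeff_pihomog; case: ifP => // _; exact: hf.
split; first by move=> m _; rewrite mcoeff0.
  by move=> f g hf hg m hm; rewrite mcoeffD hf // hg // addr0.
move=> f g hg; apply: (supported_inM (P := xpredT) (Q := P)) => // A B _.
by apply: hP; exact: subsetUr.
Qed.

Lemma supported_inX (P : pred {set 'I_n}) m : P (mnm_set m) -> supported_in P 'X_[m].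
Proof. by move=> h k hk; rewrite mcoeffX; case: eqP => // E; move: hk; rewrite -E h. Qed.

Lemma supported_in_ideal (P : pred {set 'I_n}) (J : S -> Prop) f : is_ideal J ->
  (forall m, P (mnm_set m) -> J 'X_[m]) -> supported_in P f -> J f.
Proof.
move=> iJ h hf; rewrite [f]mpolyE; apply: (ideal_sum iJ) => m _.
have [hP|/hf->] := boolP (P (mnm_set m)); first exact/(idealZ iJ)/h.
by rewrite scale0r; exact: ideal0.
Qed.

(** The substitution of 0 for the variables outside [F], a ring homomorphism with kernel
    [face_prime F]. *)
Definition restriction F f : S := \sum_(m <- msupp f | mnm_set m \subset F) f@_m *: 'X_[m].

Lemma mcoeff_restriction F f m :
  (restriction F f)@_m = if mnm_set m \subset F then f@_m else 0.
Proof.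
rewrite /restriction raddf_sum /= big_mkcond /=.
have -> : f@_m = \sum_(k <- msupp f) (f@_k *: 'X_[k] : S)@_m.
  by rewrite {1}[f]mpolyE raddf_sum.
case: ifP => hm.
  apply: eq_bigr => k _; case: ifP => // hk; rewrite mcoeffZ mcoeffX.
  by case: eqP => [E|_]; rewrite ?mulr0 //; rewrite E hm in hk.
rewrite big1 // => k _; case: ifP => // hk; rewrite mcoeffZ mcoeffX.
by case: eqP => [E|_]; rewrite ?mulr0 //; rewrite E hm in hk.
Qed.

Lemma restrictionM F f g : restriction F (f * g) = restriction F f * restriction F g.
Proof.
apply/mpolyP => m; rewrite mcoeff_restriction mcoeffM; case: ifP => hm.
  rewrite mcoeffM; apply: eq_bigr => k /eqP Em.
  have := hm; rewrite [X in mnm_set X]Em mnm_setD subUset => /andP[h1 h2].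
  by rewrite !mcoeff_restriction h1 h2.
apply/esym/mcoeffM0 => k1 k2 Em; rewrite !mcoeff_restriction.
by move: hm; rewrite Em mnm_setD subUset; do 2 case: ifP => _; rewrite // ?mul0r ?mulr0.
Qed.

(* The prime ideal generated by the variables outside [F]. *)
Definition face_prime F : S -> Prop := supported_in (fun A => ~~ (A \subset F)).

Lemma face_primeP F f : face_prime F f <-> restriction F f = 0.
Proof.
split=> [h|/mpolyP h].
  apply/mpolyP => m; rewrite mcoeff_restriction mcoeff0; case: ifP => // hm.
  by apply: h; rewrite negbK.
by move=> m /negPn hm; have := h m; rewrite mcoeff_restriction hm mcoeff0.
Qed.

Lemma face_prime_upward F : upward_closed (fun A => ~~ (A \subset F)).
Proof. by move=> A B hAB; apply: contraNN => /(subset_trans hAB). Qed.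

Lemma face_primeX F m : mnm_set m \subset F -> ~ face_prime F 'X_[m].
Proof.
move=> hm /(_ m); rewrite mcoeffX eqxx hm => /(_ isT) /eqP; apply/negP.
exact: oner_neq0.
Qed.

Lemma face_prime_prime F : is_prime_ideal (face_prime F).
Proof.
split; first by have [] := supported_in_homog (@face_prime_upward F).
  rewrite -mpolyX0; apply: face_primeX.
  by apply/subsetP => i; rewrite inE mnm0E.
move=> f g /face_primeP; rewrite restrictionM => /eqP.
by rewrite mulf_eq0 => /orP[] /eqP /face_primeP; [left|right].
Qed.

Lemma face_prime_lt F (G : {set _}) : G \proper F -> ideal_lt (face_prime F) (face_prime G).
Proof.
case/properP=> hGF [i hi hi']; split.
  by move=> f hf m hm; apply: hf; apply: contraNN hm => h; apply: contraNN h => /subset_trans; exact.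
exists 'X_i; split; last by apply: face_primeX; rewrite mnm_setU sub1set.
by apply: supported_inX; rewrite mnm_setU sub1set.
Qed.

(** Deleting the vertices of [F] one at a time enlarges the prime. This bounds from below by [#|F|]
    the dimension of a module whose annihilator lies in [face_prime F]. *)
Lemma face_prime_chain F : exists p : nat -> S -> Prop, prime_chain (face_prime F) #|F| p.
Proof.
pose G k := [set x in drop k (enum F)].
exists (fun k => face_prime (G k)).
have GS k : (k < #|F|)%N -> G k.+1 \proper G k.
  move=> hk; have hk' : (k < size (enum F))%N by rewrite -cardE.
  case: (set_0Vmem F) => [F0|[x0 _]]; first by rewrite F0 cards0 in hk.
  have Ed := drop_nth x0 hk'.
  have := enum_uniq F; rewrite -[enum F](cat_take_drop k) cat_uniq Ed /= => /and4P[_ _ hn _].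
  apply/properP; split.
    by apply/subsetP => x; rewrite !inE Ed inE => ->; rewrite orbT.
  by exists (nth x0 (enum F) k); rewrite inE // Ed mem_head.
split=> [i _|i _|i hi]; first exact: face_prime_prime.
  have : G i \subset F by apply/subsetP => x; rewrite inE => /mem_drop; rewrite mem_enum.
  move=> hGF f hf m hm; apply: hf; apply: contraNN hm => h; apply: contraNN h => /subset_trans; exact.
by apply: face_prime_lt; apply: GS.
Qed.

Lemma card_mnm_in (T : nat) A :
  (#|[set m : 'X_{1..n < T.+1} | mnm_set m \subset A]| <= T.+1 ^ #|A|)%N.
Proof.
pose phi (m : 'X_{1..n < T.+1}) : {ffun 'I_n -> 'I_T.+1} := [ffun i => inord (bmnm m i)].
have hle (m : 'X_{1..n < T.+1}) i : (bmnm m i <= T)%N.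
  have : (mdeg m < T.+1)%N := bmdeg m.
  by rewrite ltnS; apply: leq_trans; rewrite mdegE (bigD1 i) //= leq_addr.
have inj_phi : injective phi.
  move=> m1 m2 /ffunP E; apply: val_inj; apply/mnmP => i.
  by have := congr1 val (E i); rewrite !ffunE /= !inordK // ltnS hle.
rewrite -(card_imset _ inj_phi) -[X in (X ^ _)%N]card_ord -(card_pffun_on ord0).
apply: subset_leq_card; apply/subsetP => _ /imsetP[m hm ->].
apply/pffun_onP; split; last by [].
apply/subsetP => i; rewrite !inE ffunE => hi; rewrite inE in hm.
apply: (subsetP hm); rewrite inE; apply: contraNneq hi => E.
by apply/eqP/val_inj; rewrite /= E inordK.
Qed.

(** The monomials of degree at most [T] outside the ideal involve only variables from one of the [n]
    sets [G y], so there are at most [n * T.+1 ^ e] of them, and a larger family is linearly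
    dependent modulo the ideal. *)
Lemma growth_supported (P : pred {set 'I_n}) (G : 'I_n -> {set 'I_n}) e :
  (forall A, ~~ P A -> exists y, A \subset G y) -> (forall y, #|G y| <= e)%N ->
  growth_lt e.+1 (supported_in P).
Proof.
move=> hG hGe; exists n => T L y hy indep.
pose D := [set m : 'X_{1..n < T.+1} | ~~ P (mnm_set m)].
have cD : (#|D| <= n * T.+1 ^ e)%N.
  have sub : D \subset \bigcup_(y : 'I_n) [set m : 'X_{1..n < T.+1} | mnm_set m \subset G y].
    apply/subsetP => m; rewrite inE => /hG[i hi].
    by apply/bigcupP; exists i => //; rewrite inE.
  apply: leq_trans (subset_leq_card sub) _.
  apply: leq_trans (_ : \sum_(i < n) T.+1 ^ e <= _)%N; last by rewrite sum_nat_const card_ord.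
  elim/big_ind2: _ => [|a b c d hab hcd|i _]; first by rewrite cards0.
    apply: leq_trans (leq_card_setU _ _) _; exact: leq_add.
  by apply: leq_trans (card_mnm_in _ _) _; exact: leq_pexp2l.
suff : (#|L| <= #|D|)%N by move=> h; rewrite expnS mulnCA mulnC leq_mul2l (leq_trans h cD) orbT.
rewrite leqNgt; apply/negP => lt.
pose Q := \matrix_(i < #|L|, j < #|D|) (y (enum_val i))@_(enum_val j : 'X_{1..n < T.+1}).
have : kermx Q != 0.
  rewrite kermx_eq0 /row_free neq_ltn; apply/orP; left.
  exact: leq_ltn_trans (rank_leq_col Q) lt.
case/rowV0Pn=> v /sub_kermxP vQ v0.
have c0 : forall i, v 0 (enum_rank i) = 0.
  apply: indep => m hm; rewrite raddf_sum /=.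
  have [big|small] := ltnP T (mdeg m).
    by rewrite big1 // => i _; rewrite mcoeffZ hy ?mulr0.
  rewrite -ltnS in small; pose bm := BMultinom small.
  have hD : bm \in D by rewrite inE.
  have := congr1 (fun A : 'rV_ _ => A 0 (enum_rank_in hD bm)) vQ.
  rewrite !mxE => E; rewrite -[RHS]E {E}.
  rewrite (reindex (@enum_val L predT)) /=; last first.
    by exists enum_rank => ? _; [exact: enum_valK|exact: enum_rankK].
  apply: eq_bigr => i _; rewrite mxE enum_valK mcoeffZ enum_rankK_in //.
case/negP: v0; apply/eqP/rowP => i; rewrite mxE -(enum_valK i); exact: c0.
Qed.


End SquarefreeIdeals.

(** * Edge ideals and the sequentially Cohen-Macaulay condition *)

Section EdgeIdeals.
Variables (K : fieldType) (n : nat).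
Local Notation S := {mpoly K[n]}.
Implicit Types (f g : S) (A B F : {set 'I_n}).

Definition adjacent_in (e : rel 'I_n) A := [exists i in A, exists j in A, e i j].

Definition neighbors (e : rel 'I_n) A : {set 'I_n} := [set j | [exists i in A, e i j]].

Lemma adjacent_inP (e : rel 'I_n) A :
  reflect (exists i j, [/\ i \in A, j \in A & e i j]) (adjacent_in e A).
Proof.
apply: (iffP exists_inP) => [[i hi /exists_inP[j hj h]]|[i [j [hi hj h]]]]; first by exists i, j.
by exists i => //; apply/exists_inP; exists j.
Qed.

Lemma neighborsP (e : rel 'I_n) A j :
  reflect (exists2 i, i \in A & e i j) (j \in neighbors e A).
Proof. by rewrite inE; exact: exists_inP. Qed.

Lemma adjacent_in_upward e : upward_closed (adjacent_in e).
Proof.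
move=> A B /subsetP hAB /adjacent_inP[i [j [hi hj h]]].
by apply/adjacent_inP; exists i, j; split=> //; exact: hAB.
Qed.

Lemma edge_idealE (e : rel 'I_n) f : irreflexive e ->
  edge_ideal K e f <-> supported_in (adjacent_in e) f.
Proof.
move=> irr; have [iI _] := supported_in_homog K (@adjacent_in_upward e).
split=> [[k [c [a [ha ->]]]]|].
  apply: (ideal_sum iI) => l _; apply: (idealMl iI).
  have [i [j [hij ->]]] := ha l; rewrite -mpolyXD; apply: supported_inX.
  by apply/adjacent_inP; exists i, j; rewrite mnm_setD !mnm_setU !inE !eqxx orbT.
apply: supported_in_ideal.
  split.
  - by exists 0%N, (fun=> 0), (fun=> 0); split; [case | rewrite big_ord0].
  - move=> _ _ [k [c [a [ha ->]]]] [k' [c' [a' [ha' ->]]]].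
    exists (k + k')%N, (fun i => match split i with inl i => c i | inr i => c' i end),
      (fun i => match split i with inl i => a i | inr i => a' i end).
    split; first by move=> i; case: split.
    rewrite big_split_ord /=; congr (_ + _); apply: eq_bigr => i _.
      by rewrite (unsplitK (inl i)).
    by rewrite (unsplitK (inr i)).
  move=> g _ [k [c [a [ha ->]]]]; exists k, (fun i => g * c i), a; split=> //.
  by rewrite mulr_sumr; apply: eq_bigr => i _; rewrite mulrA.
move=> m /adjacent_inP[i [j [hi hj hij]]].
exists 1%N, (fun=> 'X_[m - U_(i) - U_(j)]), (fun=> 'X_i * 'X_j); split.
  by move=> _; exists i, j.
rewrite big_ord1 -!mpolyXD; congr 'X_[_]; apply/mnmP => k.
rewrite !inE in hi hj; have ij : i != j by apply: contraTneq hij => ->; rewrite irr.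
rewrite !mnmE; case: (eqVneq i k) => [<-|_]; case: (eqVneq j _) => [E|_] //=; try lia.
by rewrite E eqxx in ij.
by rewrite -E; lia.
Qed.

Lemma edge_ideal_homog (e : rel 'I_n) : irreflexive e -> homogeneous_ideal (edge_ideal K e).
Proof.
move=> irr; have [[h0 hD hM] hh] := supported_in_homog K (@adjacent_in_upward e).
split; last by move=> f d /(edge_idealE _ irr) hf; apply/(edge_idealE _ irr)/hh.
split; first exact/(edge_idealE _ irr).
  by move=> f g /(edge_idealE _ irr) hf /(edge_idealE _ irr) hg; apply/(edge_idealE _ irr)/hD.
by move=> f g /(edge_idealE _ irr) hg; apply/(edge_idealE _ irr)/hM.
Qed.

(** [N] is a filtration step [J i] contained in both face primes while [J i.+1] is not. All
    quotients from there on are Cohen-Macaulay of dimension at least [d], so [extension_vanishing]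
    applies to each of them, and the multipliers add up along the filtration. *)
Lemma scm_extension (I : S -> Prop) (F1 F2 : {set 'I_n}) d :
  sequentially_CM I -> ideal_le I (face_prime F1) -> ideal_le I (face_prime F2) ->
  (d <= #|F1|)%N -> (d <= #|F2|)%N ->
  exists N, [/\ homogeneous_ideal N, ideal_le I N, ideal_le N (face_prime F1),
    ideal_le N (face_prime F2) &
    forall e J U, homogeneous_ideal J -> growth_lt e J -> (e < d)%N ->
    partial_hom (fun=> True) N J U -> exists z, forall a m, U a m -> N (m - a * z)].
Proof.
move=> [r [J [dm [[J0 Jr] hJ Jlt Jcm dlt]]]] IF1 IF2 dF1 dF2.
pose good i := ideal_le (J i) (face_prime F1) /\ ideal_le (J i) (face_prime F2).
have [i [ir gi gSi]] : exists i, [/\ (i < r)%N, good i & ~ good i.+1].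
  apply: NNPP => H.
  have G i : (i <= r)%N -> good i.
    elim: i => [_|i IHi hi]; first by split=> f /J0; [apply: IF1 | apply: IF2].
    by apply: NNPP => ng; apply: H; exists i; split=> //; apply: IHi; exact: ltnW.
  have [hF _] := G r (leqnn r).
  by have [_ n1 _] := face_prime_prime K F1; apply: n1; apply: hF.
have di : (d <= dm i)%N.
  (* If [f] annihilates [J i.+1 / J i] and [g] in [J i.+1] is outside the prime, then [f * g] is in
     the prime and so is [f]. Hence [face_prime_chain] gives a chain over the annihilator. *)
  have aux F : ideal_le (J i) (face_prime F) -> ~ ideal_le (J i.+1) (face_prime F) ->
      (#|F| <= dm i)%N.
    move=> h1 h2; have [_ [_]] := Jcm i ir; apply.
    have [p [p1 p2 p3]] := face_prime_chain K F; exists p; split=> // k hk f hf.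
    apply: p2 => //; apply: NNPP => nf; apply: h2 => g hg.
    have [_ _ pF] := face_prime_prime K F.
    by case: (pF f g) => //; apply: h1; apply: hf.
  case: gi => g1 g2; case: (classic (ideal_le (J i.+1) (face_prime F1))) => h1.
    by apply: leq_trans dF2 _; apply: aux => // h2; apply: gSi.
  by apply: leq_trans dF1 _; apply: aux.
have mono k : (i <= k)%N -> (k <= r)%N -> ideal_le (J i) (J k).
  elim: k => [|k IHk]; first by rewrite leqn0 => /eqP -> _ f.
  rewrite leq_eqVlt => /orP[/eqP <- _ f //|hik hk f hf].
  by apply: (proj1 (Jlt k hk)); apply: IHk => //; exact: ltnW.
have dmono k : (i <= k)%N -> (k < r)%N -> (d <= dm k)%N.
  elim: k => [|k IHk]; first by rewrite leqn0 => /eqP <-.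
  rewrite leq_eqVlt => /orP[/eqP <- //|hik] hk.
  by apply: leq_trans (IHk hik (ltnW hk)) _; apply: ltnW; exact: dlt.
exists (J i); split=> //.
- by apply: hJ; exact: ltnW.
- move=> f hf; elim: (i) ir {gi gSi di mono dmono} => [_|k IHk hk]; first exact/J0.
  by apply: (proj1 (Jlt k (ltnW hk))); apply: IHk; exact: ltnW.
- by case: gi.
- by case: gi.
move=> e A U hA gA ed.
have main k : (i <= k)%N -> (k <= r)%N -> forall U, partial_hom (J k) (J i) A U ->
    exists z, J k z /\ forall a m, U a m -> J i (m - a * z).
  elim: k => [|k IHk].
    rewrite leqn0 => /eqP i0 _ V [_ Vd _]; exists 0; rewrite i0 in Vd *; split.
      by apply: ideal0; case: (hJ 0%N (leq0n r)).
    by move=> a m /Vd[_]; rewrite mulr0 subr0.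
  rewrite leq_eqVlt => /orP[/eqP Ei _|hik hk] V [Vex Vd Vc].
    exists 0; rewrite -Ei in Vd *; split.
      by apply: ideal0; case: (hJ i (ltnW ir)).
    by move=> a m /Vd[_]; rewrite mulr0 subr0.
  have [[d' [[[xs [hxs sxs]] _] [dex dmax]]] [dex' dmax']] := Jcm k hk.
  have Ed : d' = dm k by apply/eqP; rewrite eqn_leq dmax' // dmax.
  have [iJk iJk1] : is_ideal (J k) /\ is_ideal (J k.+1).
    by split; [case: (hJ k (ltnW hk)) | case: (hJ k.+1 hk)].
  have szxs : (e < size xs)%N by rewrite sxs Ed; apply: leq_trans ed _; exact: dmono.
  have [|z [Jz hz]] := extension_vanishing (hJ _ hk) (hJ _ (ltnW hk)) hA hxs gA szxs (U := V).
    split=> // a m b p h1 h2; apply: (mono k) => //; [exact: ltnW | exact: Vc].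
  have [|t [Jt ht]] := IHk hik (ltnW hk) (fun a m' => exists m, V a m /\ m' = m - a * z).
    split.
    - by move=> a /Vex[m hm]; exists (m - a * z), m.
    - by move=> a _ [m [hm ->]]; split; [case: (Vd _ _ hm) | exact: hz].
    move=> a _ b _ [m [hm ->]] [p [hp ->]].
    by rewrite (_ : _ - _ = a * p - b * m); [exact: Vc | ring].
  exists (z + t); split; first by apply: (idealD iJk1) => //; exact: (proj1 (Jlt k hk)).
  move=> a m hm; rewrite (_ : _ - _ = m - a * z - a * t); last by ring.
  by apply: ht; exists m.
move=> [Uex Ud Uc]; have [|z [_ hz]] := main r (ltnW ir) (leqnn r) U; last by exists z.
by split=> // a m /Ud[].
Qed.

Lemma scm_face_connected (e : rel 'I_n) A V1 V2 : irreflexive e ->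
  sequentially_CM (edge_ideal K e) ->
  ~~ adjacent_in e (A :|: V1) -> ~~ adjacent_in e (A :|: V2) ->
  [disjoint V1 & V2] -> V1 :|: V2 = ~: (A :|: neighbors e A) ->
  V2 != set0 -> (#|V1| <= #|V2|)%N ->
  exists2 y, y \in V2 & (#|V1 :&: neighbors e [set y]| <= 1)%N.
Proof.
move=> irr scm ind1 ind2 dis VW V20 le12.
case: (boolP [exists y in V2, (#|V1 :&: neighbors e [set y]| <= 1)%N]) => [/exists_inP//|].
rewrite negb_exists_in => /forall_inP many; exfalso.
pose F1 := A :|: V1; pose F2 := A :|: V2.
have dA (B : {set 'I_n}) : B \subset V1 :|: V2 -> [disjoint A & B].
  move=> hB; rewrite disjoint_sym disjoints_subset; apply: subset_trans hB _.
  by rewrite VW setCU subsetIl.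
have cF1 : #|F1| = (#|A| + #|V1|)%N.
  by apply/eqP; rewrite (leq_card_setU A V1).2 dA // subsetUl.
have cF2 : #|F2| = (#|A| + #|V2|)%N.
  by apply/eqP; rewrite (leq_card_setU A V2).2 dA // subsetUr.
have edgeF F : ~~ adjacent_in e F -> ideal_le (edge_ideal K e) (face_prime F).
  move=> hF f /(edge_idealE _ irr) hf m hm; apply: hf.
  by apply: contra hF; apply: adjacent_in_upward; apply: negbNE.
have le12F : (#|F1| <= #|F2|)%N by rewrite cF1 cF2 leq_add2l.
have [N [hN IN N1 N2 ext]] := scm_extension scm (edgeF _ ind1) (edgeF _ ind2) (leqnn _) le12F.
have iN : is_ideal N by case: hN.
pose nb y := neighbors e [set y].
(* A monomial outside [P] has its support in [F1] and misses the neighbours of some [y] in [V2], at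
   least two of which lie in [F1]. So [P] defines an ideal of dimension at most [#|F1| - 2]. *)
pose Q B := [forall y in V2, B :&: nb y != set0].
pose P B := ~~ (B \subset F1) || Q B.
have Pup : upward_closed P.
  move=> B C hBC /orP[h|/forall_inP h].
    by rewrite /P (contraNN _ h) // => /(subset_trans hBC).
  apply/orP; right; apply/forall_inP => y /h; apply: contraNneq => E.
  by rewrite -subset0 -E setSI.
have big y : y \in V2 -> (1 < #|F1 :&: nb y|)%N.
  move=> /many; rewrite -ltnNge => h; apply: leq_trans h _; apply: subset_leq_card.
  by apply: setSI; exact: subsetUr.
have [y0 y0V2] := set0Pn _ V20.
have F1big : (1 < #|F1|)%N.
  by apply: leq_trans (big _ y0V2) _; apply: subset_leq_card; exact: subsetIl.
have gP : growth_lt (#|F1| - 2).+1 (supported_in (K := K) P).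
  apply: (@growth_supported K n P (fun y => if y \in V2 then F1 :\: nb y else set0)).
    move=> B; rewrite negb_or negbK => /andP[BF]; rewrite negb_forall_in => /exists_inP[y hy].
    rewrite negbK => /eqP E; exists y; rewrite hy; apply/subsetP => x hx.
    rewrite inE (subsetP BF) // andbT; apply/negP => hx'.
    by move/setP/(_ x): E; rewrite !inE hx => /negbT/negP; apply; rewrite inE in hx'.
  move=> y; case: ifP => [/big h|_]; last by rewrite cards0.
  by rewrite cardsD leq_sub2l.
pose U (a m : S) := supported_in P a /\ m = monomial_of K A * restriction F1 a.
(* The successor expresses dimension at most [#|F1| - 2] as a strict bound; [F1big] ensures that the
   subtraction does not truncate. *)
have ltF1 : ((#|F1| - 2).+1 < #|F1|)%N by move: #|F1| F1big => k; lia.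
have [|z hz] := ext _ _ U (supported_in_homog K Pup) gP ltF1.
  split.
  - by move=> a ha; exists (monomial_of K A * restriction F1 a).
  - by move=> a m [].
  move=> a _ b _ [ha ->] [hb ->].
  pose R f := f - restriction F1 f.
  have hR f : supported_in (fun B => ~~ (B \subset F1)) (R f).
    move=> m; rewrite negbK => hm.
    by rewrite mcoeffB mcoeff_restriction hm subrr.
  have hr f : supported_in P f -> supported_in Q (restriction F1 f).
    move=> hf m hm; rewrite mcoeff_restriction; case: ifP => // h.
    by apply: hf; rewrite /P h.
  (* The support of a term contains [A] and some [i] outside [F1]. If [i] is in [V2], then [Q]
     supplies a neighbour of [i]; otherwise [i] is a neighbour of [A]. Either way there is an
     edge. *)
  have key f g : supported_in P g -> N (monomial_of K A * (R f * restriction F1 g)).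
    move=> hg; apply: IN; apply/(edge_idealE _ irr).
    apply: (supported_inM (P := fun B => B == A) (Q := fun B => ~~ (B \subset F1) && Q B)); last first.
    - apply: (supported_inM (P := fun B => ~~ (B \subset F1)) (Q := Q)) (hR f) (hr g hg).
      move=> B C hB /forall_inP hC; apply/andP; split.
        by apply: contraNN hB; apply: subset_trans; exact: subsetUl.
      apply/forall_inP => y /hC; apply: contraNneq => E.
      by rewrite -subset0 -E setSI // subsetUr.
    - by apply: supported_inX; rewrite set_mnmK.
    move=> B C /eqP -> /andP[/subsetPn[i iC iF] /forall_inP hC]; apply/adjacent_inP.
    have [iV2|iV2] := boolP (i \in V2).
      have /set0Pn[j] := hC i iV2; rewrite inE => /andP[jC /neighborsP[i']].
      by rewrite inE => /eqP -> hij; exists i, j; rewrite !inE iC jC !orbT.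
    have iV : i \notin V1 :|: V2.
      by rewrite inE negb_or iV2 andbT; apply: contraNN iF; rewrite inE => ->; rewrite orbT.
    move: iV; rewrite VW inE negbK inE => /orP[iA|/neighborsP[j jA hji]].
      by case/negP: iF; rewrite inE iA.
    by exists j, i; rewrite !inE jA iC orbT.
  rewrite (_ : _ - _ = monomial_of K A * (R a * restriction F1 b) -
    monomial_of K A * (R b * restriction F1 a)); last by rewrite /R; ring.
  by apply: (idealB iN); exact: key.
(* Testing the multiplier on [t_V1] puts [t_A - z] in the prime of [F1]; testing it below on the
   variable [y0] puts [z] in the prime of [F2]. No element of either prime has a term in [t_A], so
   its coefficient in [z] would be both 1 and 0. *)
have coefA : (monomial_of K A - z)@_(set_mnm A) = 0.
  have [_ _ p1] := face_prime_prime K F1.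
  have rV1 : restriction F1 (monomial_of K V1) = monomial_of K V1.
    apply/mpolyP => m; rewrite mcoeff_restriction; case: ifP => // hm.
    rewrite mcoeffX; case: eqP => // E; move: hm.
    by rewrite -E set_mnmK subsetUr.
  case: (p1 (monomial_of K V1) (monomial_of K A - z)).
  - rewrite (_ : _ * _ = monomial_of K A * restriction F1 (monomial_of K V1) - monomial_of K V1 * z).
      apply: N1; apply: hz; split=> //; apply: supported_inX; rewrite set_mnmK.
      apply/orP; right; apply/forall_inP => y /many; rewrite -ltnNge => h.
      by rewrite -card_gt0; exact: ltnW.
    by rewrite rV1; ring.
  - by move=> h; case: (@face_primeX K _ F1 (set_mnm V1)) => //; rewrite set_mnmK subsetUr.
  by apply; rewrite set_mnmK negbK subsetUl.
have coefz : z@_(set_mnm A) = 0.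
  have [_ _ p2] := face_prime_prime K F2.
  have y0F1 : y0 \notin F1.
    rewrite inE negb_or; apply/andP; split.
      by have := dA _ (subsetUr V1 V2); rewrite disjoint_sym => /disjointFr ->.
    by move: dis; rewrite disjoint_sym => /disjointFr ->.
  have r0 : restriction F1 ('X_y0 : S) = 0.
    by apply/face_primeP; apply: supported_inX; rewrite mnm_setU sub1set.
  case: (p2 'X_y0 z).
  - rewrite (_ : _ * _ = - (monomial_of K A * restriction F1 'X_y0 - 'X_y0 * z)); last by rewrite r0; ring.
    have [i2 _] := supported_in_homog K (@face_prime_upward _ F2).
    apply: (idealN i2); apply: N2; apply: hz; split=> //; apply: supported_inX.
    by rewrite mnm_setU /P sub1set y0F1.
  - by move=> h; case: (@face_primeX K _ F2 U_(y0)) => //; rewrite mnm_setU sub1set inE y0V2 orbT.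
  by apply; rewrite set_mnmK negbK subsetUl.
move: coefA; rewrite mcoeffB coefz subr0 mcoeffX eqxx => /eqP.
by rewrite oner_eq0.
Qed.

End EdgeIdeals.

(** * Koszul homology and regularity *)

(* The Koszul complex of a list of [N] elements with coefficients in [V]:
   the entry at [b : seq bool] of size [N] of a chain is its coefficient on
   the product of the basis elements selected by [b], so that the homological
   degree is [count id b]. *)
Section Koszul.
Variable R : comNzRingType.

(** The sign rule is [d (e_x /\ u) = x u - e_x /\ d u], the first element of the list leading the
    product. *)
Fixpoint koszul_d (V : lmodType R) (xs : seq R) (w : seq bool -> V) (b : seq bool) : V :=
  match xs, b with
  | x :: xs', true :: b' => - koszul_d xs' (fun c => w (true :: c)) b'
  | x :: xs', false :: b' => koszul_d xs' (fun c => w (false :: c)) b' + x *: w (true :: b')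
  | _, _ => 0
  end.

Variable V : lmodType R.
Implicit Types (w : seq bool -> V) (b : seq bool).

Lemma eq_koszul_d xs w w' b :
  (forall c, size c = size b -> count id c = (count id b).+1 -> w c = w' c) ->
  koszul_d xs w b = koszul_d xs w' b.
Proof.
elim: xs b w w' => [|x xs IH] [|[] b] w w' h //=.
  by congr (- _); apply: IH => c hs hc; apply: h => /=; rewrite ?hs ?hc.
congr (_ + _ *: _); last exact: h.
by apply: IH => c hs hc; apply: h => /=; rewrite ?hs ?hc.
Qed.

Lemma koszul_dD xs w w' b :
  koszul_d xs (fun c => w c + w' c) b = koszul_d xs w b + koszul_d xs w' b.
Proof.
elim: xs b w w' => [|x xs IH] [|[] b] w w' /=; rewrite ?addr0 //.
  by rewrite IH opprD.
by rewrite IH scalerDr addrACA.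
Qed.

Lemma koszul_dZ xs a w b : koszul_d xs (fun c => a *: w c) b = a *: koszul_d xs w b.
Proof.
elim: xs b w => [|x xs IH] [|[] b] w /=; rewrite ?scaler0 //.
  by rewrite IH scalerN.
by rewrite IH scalerDr !scalerA mulrC.
Qed.

Lemma koszul_dN xs w b : koszul_d xs (fun c => - w c) b = - koszul_d xs w b.
Proof.
rewrite -scaleN1r -koszul_dZ; apply: eq_koszul_d => c _ _; by rewrite scaleN1r.
Qed.

Lemma koszul_d0 xs b : koszul_d xs (fun _ => 0 : V) b = 0.
Proof.
rewrite -[RHS](scale0r (koszul_d xs (fun _ => 0 : V) b)) -koszul_dZ.
by apply: eq_koszul_d => *; rewrite scaler0.
Qed.

Lemma koszul_dd xs w b : koszul_d xs (koszul_d xs w) b = 0.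
Proof.
elim: xs b w => [|x xs IH] [|[] b] w //=.
  by rewrite (koszul_dN xs (koszul_d xs (fun c => w (true :: c)))) IH !oppr0.
rewrite (koszul_dD xs (koszul_d xs (fun c => w (false :: c)))) IH add0r koszul_dZ.
by rewrite scalerN subrr.
Qed.

Lemma koszul_d_mulmx xs k l (D : 'M[R]_(k, l)) (w : seq bool -> 'rV[R]_k) b :
  koszul_d xs (fun c => w c *m D) b = koszul_d xs w b *m D.
Proof.
elim: xs b w => [|x xs IH] [|[] b] w /=; rewrite ?mul0mx //.
  by rewrite IH mulNmx.
by rewrite IH mulmxDl scalemxAl.
Qed.

End Koszul.

Section KoszulVariables.
Variables (K : fieldType) (n : nat).
Local Notation S := {mpoly K[n]}.
Implicit Types (i : 'I_n) (m : 'X_{1..n}) (vs : seq 'I_n) (b : seq bool) (f g : S).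

Local Notation vars vs := [seq ('X_i : S) | i <- vs].

Lemma mcoeff_mulX_eq0 i f m : m i = 0%N -> ('X_i * f)@_m = 0.
Proof.
move=> hm; apply: mcoeffM0 => k1 k2 Em; rewrite mcoeffX; case: eqP => [E|_]; last by rewrite mul0r.
by move: hm; rewrite Em -E mnmDE mnm1E eqxx.
Qed.

Lemma mcoeff_mulX i f m : ('X_i * f)@_(m + U_(i))%MM = f@_m.
Proof. by rewrite mulrC addmC mcoeffMX. Qed.

Definition quotientX i f : S := \sum_(m <- msupp f | m i != 0%N) f@_m *: 'X_[(m - U_(i))%MM].

Lemma quotientXE i f m : m i != 0%N -> ('X_i * quotientX i f)@_m = f@_m.
Proof.
move=> hm; have Em : m = ((m - U_(i)) + U_(i))%MM by rewrite submK // lep1mP.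
rewrite {1}Em mcoeff_mulX /quotientX raddf_sum /= big_mkcond /=.
have -> : f@_m = \sum_(k <- msupp f) (f@_k *: 'X_[k] : S)@_m.
  by rewrite {1}[f]mpolyE raddf_sum.
apply: eq_bigr => k _; rewrite !mcoeffZ !mcoeffX; have [->|ne] := eqVneq k m.
  by rewrite hm eqxx.
rewrite mulr0; case: ifP => // hk; case: eqP => [E|_]; last by rewrite mulr0.
by case/eqP: ne; rewrite Em -E submK // lep1mP.
Qed.

Lemma koszul_d_coeff k vs (w : seq bool -> 'rV[S]_k) b l m :
  (forall i, i \in vs -> m i = 0%N) -> (koszul_d (vars vs) w b 0 l)@_m = 0.
Proof.
elim: vs b w => [|i vs IH] [|[] b] w hm /=; rewrite ?mxE ?mcoeff0 //.
  by rewrite mcoeffN IH ?oppr0 // => j hj; apply: hm; rewrite inE hj orbT.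
rewrite mcoeffD IH ?add0r; last by move=> j hj; apply: hm; rewrite inE hj orbT.
by rewrite mcoeff_mulX_eq0 // hm ?mem_head.
Qed.

Lemma koszul_exact0 k vs (v : 'rV[S]_k) :
  (forall l m, (forall i, i \in vs -> m i = 0%N) -> (v 0 l)@_m = 0) ->
  exists w, forall b, size b = size vs -> count id b = 0%N -> v = koszul_d (vars vs) w b.
Proof.
elim: vs v => [|i vs IH] v hv.
  exists (fun=> 0) => b _ _ /=; apply/rowP => l; rewrite mxE; apply/mpolyP => m.
  by rewrite mcoeff0 hv.
pose q := \row_l quotientX i (v 0 l).
have [w hw] : exists w, forall b, size b = size vs -> count id b = 0%N ->
    v - 'X_i *: q = koszul_d (vars vs) w b.
  apply: IH => l m hm; rewrite !mxE mcoeffB.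
  have [m0|m1] := eqVneq (m i) 0%N; last by rewrite quotientXE // subrr.
  rewrite mcoeff_mulX_eq0 // subr0 hv // => j.
  by rewrite inE => /orP[/eqP ->//|/hm].
exists (fun b => if b is true :: b' then q else if b is false :: b' then w b' else 0).
move=> [|[] b] //= [hs] hc.
by rewrite -(hw b) //= subrK.
Qed.

(** The complex is the mapping cone of the first variable acting on the complex of the others: the
    part of a cycle that selects this variable is a boundary [d z], and correcting the other part by
    [z] leaves a cycle for the shorter list. *)
Lemma koszul_exact k vs p (w : seq bool -> 'rV[S]_k) : uniq vs ->
  (forall b, size b = size vs -> count id b = p -> koszul_d (vars vs) w b = 0) ->
  exists h, forall b, size b = size vs -> count id b = p.+1 -> w b = koszul_d (vars vs) h b.
Proof.
elim: vs p w => [|i vs IH] p w.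
  by move=> _ _; exists (fun=> 0) => -[|[]].
rewrite /= => /andP[ivs uvs] hw.
have [z hz] : exists z, forall b, size b = size vs -> count id b = p ->
    w (true :: b) = koszul_d (vars vs) z b.
  case: p hw => [|p] hw; last first.
    apply: IH => // b hs hc; have := hw (true :: b); rewrite /= hs hc => /(_ erefl erefl) /eqP.
    by rewrite oppr_eq0 => /eqP.
  (* In lowest degree the cycle condition does not bear on the selected part alone. Instead, the
     variable [i] is a nonzerodivisor modulo the others, so the entry at [o], the only index of
     degree 0, lies in their ideal. *)
  pose o := nseq (size vs) false.
  have b0 b : size b = size vs -> count id b = 0%N -> b = o.
    rewrite /o; elim: (vs) b => [|? ? IHv] [|[] b] //= [hs] hc; by rewrite (IHv b).
  have [so co] : size o = size vs /\ count id o = 0%N by rewrite size_nseq count_nseq mul0n.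
  have [z hz] : exists z, forall b, size b = size vs -> count id b = 0%N ->
      w (true :: o) = koszul_d (vars vs) z b.
    apply: koszul_exact0 => l m hm; have := hw (false :: o).
    rewrite /= so co => /(_ erefl erefl) /rowP/(_ l); rewrite !mxE => /(congr1 (mcoeff (m + U_(i))%MM)).
    rewrite mcoeffD mcoeff_mulX mcoeff0 koszul_d_coeff ?add0r // => j hj.
    by rewrite mnmDE hm // mnm1E; case: eqP hj => // <-; rewrite (negbTE ivs).
  by exists z => b hs hc; rewrite (b0 b) // (hz o).
have [|h hh] := IH p (fun b => w (false :: b) + 'X_i *: z b) uvs; last first.
  exists (fun b => if b is true :: b' then - z b' else if b is false :: b' then h b' else 0).
  move=> [|[] b] //= [hs] hc.
    by rewrite koszul_dN opprK; apply: hz => //; lia.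
  by rewrite -hh // scalerN addrK.
move=> b hs hc; rewrite koszul_dD koszul_dZ -hz //.
by have := hw (false :: b); rewrite /= hs hc => ->.
Qed.

End KoszulVariables.

(** * Homogeneous components in integer degrees *)

Section IntegerDegrees.
Variables (K : fieldType) (n : nat).
Local Notation S := {mpoly K[n]}.

Definition component (a : int) (f : S) : S :=
  if a is Posz d then pihomog mdeg d f else 0.

Lemma component_homog a f : homog_of_degree a (component a f).
Proof. by case: a => d //=; exact: pihomogP. Qed.

Lemma component_id a f : homog_of_degree a f -> component a f = f.
Proof. by case: a => d //= h; exact: pihomog_dE. Qed.

Lemma component_sum a (T : Type) (r : seq T) (P : pred T) (F : T -> S) :
  component a (\sum_(i <- r | P i) F i) = \sum_(i <- r | P i) component a (F i).
Proof. by case: a => d /=; rewrite ?linear_sum // big1. Qed.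

Lemma componentB a f g : component a (f - g) = component a f - component a g.
Proof. by case: a => d /=; rewrite ?linearB ?subr0. Qed.

Lemma componentM a c f g : homog_of_degree c g ->
  component (a + c) (f * g) = component a f * g.
Proof.
case: c => [c|c] /= hg; last by rewrite hg !mulr0; case: (a + _)%R => d /=; rewrite ?linear0.
rewrite mulrC; case: a => a /=.
  by rewrite (pihomogM_homog _ _ hg) leq_addl addnK mulrC.
rewrite mul0r; case E : (Negz a + c) => [d|d] //=.
by rewrite (pihomogM_homog _ _ hg) ifF //; lia.
Qed.

Lemma homog_of_degreeD a (f g : S) :
  homog_of_degree a f -> homog_of_degree a g -> homog_of_degree a (f + g).
Proof. by case: a => d /=; [exact: rpredD | move=> -> ->; rewrite addr0]. Qed.

Lemma homog_of_degreeN a (f : S) : homog_of_degree a f -> homog_of_degree a (- f).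
Proof. by case: a => d /=; [rewrite rpredN | move=> ->; rewrite oppr0]. Qed.

Lemma homog_of_degree0 a : homog_of_degree a (0 : S).
Proof. by case: a => d //=; exact: rpred0. Qed.

Lemma homog_of_degreeM a c (f g : S) :
  homog_of_degree a f -> homog_of_degree c g -> homog_of_degree (a + c) (f * g).
Proof. by move=> hf hg; rewrite -(component_id hf) -(componentM _ _ hg); exact: component_homog. Qed.

(** Taking components commutes with a homogeneous map, so each entry of [w] can be replaced by its
    component of the expected degree. *)
Lemma homogeneous_lift a c (D : 'M[S]_(a, c)) (dk : 'I_a -> int) (dl : 'I_c -> int)
    (t : int) (w : 'rV[S]_a) :
  (forall k l, homog_of_degree (dk k - dl l) (D k l)) ->
  (forall l, homog_of_degree (t - dl l) ((w *m D) 0 l)) ->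
  exists w' : 'rV[S]_a, (forall k, homog_of_degree (t - dk k) (w' 0 k)) /\ w *m D = w' *m D.
Proof.
move=> hD hw; exists (\row_k component (t - dk k) (w 0 k)); split.
  by move=> k; rewrite mxE; exact: component_homog.
apply/rowP => l; rewrite -(component_id (hw l)) !mxE component_sum.
apply: eq_bigr => k _; rewrite mxE -(componentM _ _ (hD k l)).
by congr (component _ _); ring.
Qed.

Lemma koszul_d_homog xs k (w : seq bool -> 'rV[S]_k) b (l : 'I_k) (t : int) :
  (forall i, homog_of_degree 1 (nth 0 xs i)) ->
  (forall c, size c = size b -> count id c = (count id b).+1 -> homog_of_degree t (w c 0 l)) ->
  homog_of_degree (t + 1) (koszul_d xs w b 0 l).
Proof.
move=> hxs; elim: xs b w hxs => [|x xs IH] [|[] b] w hxs hw /=; rewrite ?mxE; try exact: homog_of_degree0.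
  apply: homog_of_degreeN; apply: IH => [i|c hs hc]; first exact: (hxs i.+1).
  by apply: hw; rewrite /= ?hs ?hc.
apply: homog_of_degreeD.
  apply: IH => [i|c hs hc]; first exact: (hxs i.+1).
  by apply: hw; rewrite /= ?hs ?hc.
rewrite mulrC; apply: homog_of_degreeM; last exact: (hxs 0%N).
exact: hw.
Qed.
End IntegerDegrees.

(** * Vanishing of Koszul homology above the regularity *)

Section Regularity.
Variables (K : fieldType) (n : nat).
Local Notation S := {mpoly K[n]}.
Variables (I : S -> Prop) (hI : homogeneous_ideal I) (F : graded_free_resolution I) (r : int).
Hypothesis F_le : forall i (k : 'I_(fr_rank F i)), fr_deg k - i%:Z <= r.
Variables (vs : seq 'I_n) (uvs : uniq vs) (vsT : forall i, i \in vs).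
Local Notation d := (koszul_d [seq ('X_i : S) | i <- vs]).
Local Notation chain p b := (size b = size vs /\ count id b = p).

Lemma nth_vars_homog i : homog_of_degree 1 (nth 0 [seq ('X_i : S) | i <- vs] i).
Proof.
have [lt|ge] := ltnP i (size vs); last by rewrite nth_default ?size_map //; exact: homog_of_degree0.
have hX j : homog_of_degree 1 ('X_j : S) by rewrite /= dhomogX /= mdeg1.
by case: vs lt => [|j vs'] // lt; rewrite (nth_map j).
Qed.

(* Diagram chase in the double complex of [F] and the Koszul complex. *)
Lemma koszul_lift p : forall q (w : seq bool -> 'rV[S]_(fr_rank F q)) (c : int),
  (forall b, chain p b -> forall l, homog_of_degree (c - p%:Z - fr_deg l) (w b 0 l)) ->
  (forall b p', p = p'.+1 -> chain p' b -> exists u, d w b = u *m fr_diff F q) ->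
  (q + p)%:Z + r < c ->
  exists h, forall b, chain p b -> exists u, w b - d h b = u *m fr_diff F q.
Proof.
elim: p => [|p IH] q w c hw hd hc.
  (* Here the entries have degree [c - fr_deg l], which is positive by [F_le] and the bound on [c];
     without constant terms they form a boundary. *)
  have [h hh] : exists h, forall b, size b = size vs -> count id b = 0%N ->
      w (nseq (size vs) false) = d h b.
    apply: koszul_exact0 => l m hm.
    have m0 : m = 0%MM by apply/mnmP => i; rewrite hm // mnm0E.
    have cho : chain 0 (nseq (size vs) false) by rewrite size_nseq count_nseq mul0n.
    have := hw _ cho l; have := F_le l.
    case E : (c - 0%:Z - fr_deg l) => [k|k] hl /=; last by move=> ->; rewrite mcoeff0.
    move=> /dhomog_nemf_coeff; apply; rewrite /= m0 mdeg0; lia.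
  exists h => b [hs hb]; exists 0; rewrite mul0mx -hh //.
  suff -> : nseq (size vs) false = b by rewrite subrr.
  by elim: (vs) b hs hb => [|? ? IHv] [|[] b] //= [hs] hb; rewrite (IHv b).
(* The lift [w'] of [d w] has [p] lowered and [q] raised by one, so that the bound on [c], which
   involves [q + p], is unchanged. *)
have [w' hw'] : exists w' : seq bool -> 'rV[S]_(fr_rank F q.+1), forall b, chain p b ->
    (forall k, homog_of_degree (c - p%:Z - fr_deg k) (w' b 0 k)) /\ d w b = w' b *m fr_diff F q.
  have ex b : exists u : 'rV[S]_(fr_rank F q.+1), chain p b ->
      (forall k, homog_of_degree (c - p%:Z - fr_deg k) (u 0 k)) /\ d w b = u *m fr_diff F q.
    case: (classic (chain p b)) => [hb|nb]; last by exists 0.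
    have [u hu] := hd b p erefl hb.
    have [|u' [hu' Eu']] := homogeneous_lift (t := c - p%:Z) (w := u) (@fr_diff_homog _ _ _ F q).
      move=> l; rewrite -hu (_ : c - p%:Z - fr_deg l = (c - p.+1%:Z - fr_deg l) + 1); last by lia.
      apply: koszul_d_homog; first exact: nth_vars_homog.
      by case: hb => hs hb e hse he; apply: hw; rewrite hse he hs hb.
    by exists u' => _; split=> //; rewrite hu.
  exists (fun b => proj1_sig (constructive_indefinite_description _ (ex b))) => b.
  exact: (proj2_sig (constructive_indefinite_description _ (ex b))).
have [|||h hh] := IH q.+1 w' c.
- by move=> b /hw'[].
- move=> b p' Ep [hs hb]; apply/fr_exact.
  rewrite -koszul_d_mulmx -[RHS](koszul_dd [seq ('X_i : S) | i <- vs] w b).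
  by apply: eq_koszul_d => e hse he; rewrite (hw' e _).2 // hse he hs hb Ep.
- by rewrite addSn -addnS.
have [|h' hh'] := koszul_exact (p := p) (w := fun b => w b - h b *m fr_diff F q) uvs.
  move=> b hs hb; rewrite (koszul_dD _ w (fun b => - (h b *m fr_diff F q))) koszul_dN.
  rewrite koszul_d_mulmx; have [|_ ->] := hw' b; first by [].
  rewrite -mulmxBl; have [u ->] := hh b (conj hs hb).
  by apply/fr_exact; exists u.
exists h' => b [hs hb]; exists (h b); by rewrite -hh' // opprB addrCA subrr addr0.
Qed.

Lemma koszul_d_ideal (J : S -> Prop) xs (w : seq bool -> 'rV[S]_1) b : is_ideal J ->
  (forall c, size c = size b -> count id c = (count id b).+1 -> J (w c 0 0)) ->
  J (koszul_d xs w b 0 0).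
Proof.
move=> iJ; elim: xs b w => [|x xs IH] [|[] b] w hw /=; rewrite ?mxE; try exact: ideal0.
  apply: idealN => //; apply: IH => c hs hc.
  by apply: hw; rewrite /= ?hs ?hc.
apply: idealD => //.
  by apply: IH => c hs hc; apply: hw; rewrite /= ?hs ?hc.
by apply: idealMl => //; exact: hw.
Qed.

(** This is [Tor_p(S/I, K)_c = 0] for [c > p + r], computed by the Koszul complex of [S/I]; its
    basis elements have degree 1, so a [p]-chain of degree [c] has entries of degree [c - p].
    Lifting the chain to [F_0] brings it into the double complex. *)
Lemma koszul_homology_vanishing p (w : seq bool -> 'rV[S]_1) (c : int) :
  (forall b, chain p b -> homog_of_degree (c - p%:Z) (w b 0 0)) ->
  (forall b p', p = p'.+1 -> chain p' b -> I (d w b 0 0)) ->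
  p%:Z + r < c ->
  exists h : seq bool -> 'rV[S]_1, forall b, chain p b -> I ((w b - d h b) 0 0).
Proof.
have [iI hIc] := hI.
have Icomp a f : I f -> I (component a f) by case: a => k //= hf; [exact: hIc | exact: ideal0].
move=> hw hd hc.
have [w0 hw0] : exists w0 : seq bool -> 'rV[S]_(fr_rank F 0), forall b, chain p b ->
    (forall k, homog_of_degree (c - p%:Z - fr_deg k) (w0 b 0 k)) /\
    I ((w b - w0 b *m fr_aug F) 0 0).
  have ex b : exists u : 'rV[S]_(fr_rank F 0), chain p b ->
      (forall k, homog_of_degree (c - p%:Z - fr_deg k) (u 0 k)) /\ I ((w b - u *m fr_aug F) 0 0).
    case: (classic (chain p b)) => [hb|nb]; last by exists 0.
    have [u hu] := fr_aug_surj F (w b 0 0).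
    exists (\row_k component (c - p%:Z - fr_deg k) (u 0 k)) => _; split.
      by move=> k; rewrite mxE; exact: component_homog.
    have := Icomp (c - p%:Z) _ hu; rewrite componentB (component_id (hw b hb)) !mxE component_sum.
    congr (I (_ - _)); apply: eq_bigr => k _; rewrite mxE -(componentM _ _ (fr_aug_homog k)).
    by congr (component _ _); ring.
  exists (fun b => proj1_sig (constructive_indefinite_description _ (ex b))) => b.
  exact: (proj2_sig (constructive_indefinite_description _ (ex b))).
have [|||h hh] := koszul_lift (p := p) (q := 0) (w := w0) (c := c).
- by move=> b /hw0[].
- move=> b p' Ep [hs hb]; apply/fr_exact0.
  rewrite -koszul_d_mulmx.
  have -> : d (fun b => w0 b *m fr_aug F) b = d w b - d (fun b => w b - w0 b *m fr_aug F) b.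
    rewrite -koszul_dN -koszul_dD; apply: eq_koszul_d => e _ _.
    by rewrite opprB addrCA subrr addr0.
  rewrite mxE [X in _ + X]mxE; apply: idealB => //; first exact: (hd b p').
  apply: koszul_d_ideal => // e hse he; have [|_] := hw0 e; last by [].
  by rewrite hse he hs hb Ep.
- by rewrite add0n.
exists (fun b => h b *m fr_aug F) => b hb; rewrite koszul_d_mulmx.
have [u hu] := hh b hb; have [_ Iw] := hw0 b hb.
rewrite (_ : _ - _ = (w b - w0 b *m fr_aug F) + (w0 b - d h b) *m fr_aug F); last first.
  by rewrite mulmxBl addrA subrK.
by rewrite mxE; apply: idealD => //; apply/fr_exact0; exists u.
Qed.
End Regularity.

(** * The Koszul class of an induced matching *)

Section InducedMatching.
Variables (K : fieldType) (n : nat) (e : rel 'I_n).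
Hypotheses (e_sym : ssrbool.symmetric e) (e_irr : irreflexive e).
Local Notation S := {mpoly K[n]}.
Local Notation I := (edge_ideal K e).
Implicit Types (l : seq ('I_n * 'I_n)) (b : seq bool) (m : 'X_{1..n}).

Fixpoint vertices l : seq 'I_n := if l is (x, y) :: l' then [:: x, y & vertices l'] else [::].

Fixpoint induced_matching l : bool :=
  if l is (x, y) :: l' then
    [&& e x y, all (fun v => ~~ e x v && ~~ e y v) (vertices l') & induced_matching l']
  else true.

Lemma induced_matching_nbr l v : induced_matching l -> v \in vertices l ->
  exists2 u, u \in vertices l & e v u.
Proof.
elim: l => [|[x y] l IH] //= /and3P[exy _ ml]; rewrite !inE => /or3P[/eqP->|/eqP->|/(IH ml)[u hu h]].
- by exists y; rewrite // !inE eqxx orbT.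
- by exists x; rewrite 1?e_sym // !inE eqxx.
- by exists u; rewrite // !inE hu !orbT.
Qed.

(** A vertex of the tail has a neighbour in the tail, whereas [x] and [y] have none there, so it
    differs from both. *)
Lemma induced_matching_uniq l : induced_matching l -> uniq (vertices l).
Proof.
elim: l => [|[x y] l IH] //= /and3P[exy /allP h ml]; rewrite IH // inE andbT negb_or.
apply/andP; split; last first.
  by apply/negP => /(induced_matching_nbr ml)[u /h /andP[_ /negP]].
apply/andP; split; first by apply: contraTneq exy => ->; rewrite e_irr.
by apply/negP => /(induced_matching_nbr ml)[u /h /andP[/negP]].
Qed.

Variable others : seq 'I_n.
Local Notation vs l := (vertices l ++ others).
Local Notation vars vs := [seq ('X_i : S) | i <- vs].

(* The cycle [x_1 e_(y_1) /\ ... /\ x_m e_(y_m)], and a linear form on chains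
   which is [1] on it and vanishes on the boundaries and on the chains with
   entries in [I]. *)
Fixpoint matching_cycle l b : 'rV[S]_1 :=
  match l, b with
  | [::], _ => if has id b then 0 else const_mx 1
  | (x, y) :: l', false :: true :: b' => 'X_x *: matching_cycle l' b'
  | _, _ => 0
  end.

Fixpoint matching_form l (w : seq bool -> 'rV[S]_1) (m : 'X_{1..n}) : K :=
  if l is (x, y) :: l' then
    matching_form l' (fun c => w [:: true, false & c]) (m + U_(y)) +
    matching_form l' (fun c => w [:: false, true & c]) (m + U_(x))
  else (w (nseq (size others) false) 0 0)@_m.

Lemma eq_matching_form l w w' m :
  (forall b, size b = size (vs l) -> count id b = size l -> w b = w' b) ->
  matching_form l w m = matching_form l w' m.
Proof.
elim: l w w' m => [|[x y] l IH] w w' m h /=.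
  by rewrite h // ?size_nseq // count_nseq mul0n.
by congr (_ + _); apply: IH => b hs hc; apply: h => /=; rewrite ?hs ?hc.
Qed.

Lemma matching_formB l w w' m :
  matching_form l (fun c => w c - w' c) m = matching_form l w m - matching_form l w' m.
Proof.
elim: l w w' m => [|[x y] l IH] w w' m /=; first by rewrite !mxE mcoeffB.
rewrite (IH (fun c => w [:: true, false & c])) (IH (fun c => w [:: false, true & c])).
by rewrite opprD addrACA.
Qed.

Lemma matching_form0 l m : matching_form l (fun=> 0) m = 0.
Proof. by elim: l m => [|[x y] l IH] m /=; rewrite ?mxE ?mcoeff0 // !IH addr0. Qed.

Lemma matching_formN l w m : matching_form l (fun c => - w c) m = - matching_form l w m.
Proof.
elim: l w m => [|[x y] l IH] w m /=; first by rewrite !mxE mcoeffN.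
rewrite (IH (fun c => w [:: true, false & c])) (IH (fun c => w [:: false, true & c])).
by rewrite opprD.
Qed.

Lemma matching_formX l i w m :
  matching_form l (fun c => 'X_i *: w c) (m + U_(i)) = matching_form l w m.
Proof.
elim: l w m => [|[x y] l IH] w m /=; first by rewrite mxE mcoeff_mulX.
have E z : (m + U_(i) + U_(z) = m + U_(z) + U_(i))%MM by rewrite -!addmA (addmC U_(i)%MM).
by rewrite !E (IH (fun c => w [:: true, false & c])) (IH (fun c => w [:: false, true & c])).
Qed.

(** By induction only the chains selecting both [x] and [y] contribute. Since
    [d (e_x /\ e_y) = x e_y - y e_x], their coefficients are read twice, with opposite signs. *)
Lemma matching_form_koszul_d l w m : uniq (vs l) -> (forall i, i \in others -> m i = 0%N) ->
  matching_form l (koszul_d (vars (vs l)) w) m = 0.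
Proof.
elim: l w m => [|[x y] l IH] w m /=; first by move=> _ hm; rewrite koszul_d_coeff.
rewrite !inE !mem_cat !negb_or => /and3P[/and3P[_ _ hx] /andP[_ hy] u] hm.
have nU i z : z \notin others -> i \in others -> (m + U_(z))%MM i = 0%N.
  by move=> hz hi; rewrite mnmDE hm // mnm1E; case: eqP hz => // ->; rewrite hi.
have D (w1 w2 : seq bool -> 'rV[S]_1) (k : 'X_{1..n}) : (forall i, i \in others -> k i = 0%N) ->
    matching_form l (fun c => koszul_d (vars (vs l)) w1 c - w2 c) k = - matching_form l w2 k.
  by move=> hk; rewrite (matching_formB l (koszul_d (vars (vs l)) w1)) IH // sub0r.
rewrite (eq_matching_form (w' := fun c =>
   koszul_d (vars (vs l)) (fun c => - w [:: true, false & c]) c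
   - 'X_y *: w [:: true, true & c])); last by move=> b _ _; rewrite koszul_dN opprD.
rewrite (D _ (fun c => 'X_y *: w [:: true, true & c])) => [|i]; last exact: nU.
rewrite [X in _ + X](eq_matching_form (w' := fun c =>
   koszul_d (vars (vs l)) (fun c => - w [:: false, true & c]) c
   - (- ('X_x *: w [:: true, true & c])))); last by move=> b _ _; rewrite koszul_dN opprK.
rewrite (D _ (fun c => - ('X_x *: w [:: true, true & c]))) => [|i]; last exact: nU.
rewrite (matching_formN l (fun c => 'X_x *: w [:: true, true & c])) opprK.
by rewrite !(matching_formX l _ (fun c => w [:: true, true & c])) addNr.
Qed.

(** The form reads coefficients only at monomials whose support adds one end of each edge to that of
    [m]. Such supports are independent, and elements of [I] have no term there. *)
Lemma matching_form_ideal l (w : seq bool -> 'rV[S]_1) m : induced_matching l ->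
  ~~ adjacent_in e (mnm_set m) ->
  (forall u v, u \in mnm_set m -> v \in vertices l -> ~~ e u v) ->
  (forall b, size b = size (vs l) -> count id b = size l -> I (w b 0 0)) ->
  matching_form l w m = 0.
Proof.
elim: l w m => [|[x y] l IH] w m.
  move=> _ hm _ hw /=; have Iw : I (w (nseq (size others) false) 0 0).
    by apply: hw; rewrite ?size_nseq // count_nseq mul0n.
  by move/(edge_idealE _ e_irr): Iw; apply.
move=> /= /and3P[exy /allP hxy ml] hm hmv hw.
have step z : z \in [:: x; y] -> ~~ adjacent_in e (mnm_set (m + U_(z))) /\
    forall u v, u \in mnm_set (m + U_(z)) -> v \in vertices l -> ~~ e u v.
  move=> hz; have hzv : z \in [:: x, y & vertices l].
    by move: hz; rewrite !inE => /orP[] ->; rewrite ?orbT.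
  rewrite mnm_setD mnm_setU; split.
    apply/adjacent_inP => -[i [j []]]; rewrite !inE => /orP[hi|/eqP->] /orP[hj|/eqP->] h.
    - by case/adjacent_inP: hm; exists i, j; rewrite !inE.
    - by have := hmv i z; rewrite inE hi h => /(_ isT hzv).
    - by have := hmv j z; rewrite inE hj e_sym h => /(_ isT hzv).
    - by rewrite e_irr in h.
  move=> u v; rewrite inE => /orP[hu|]; last first.
    by rewrite inE => /eqP -> /hxy /andP[]; move: hz; rewrite !inE => /orP[] /eqP ->.
  by move=> hv; apply: hmv => //; rewrite !inE hv !orbT.
have [sx1 sx2] := step x (mem_head _ _); have [sy1 sy2] := step y (mem_last x [:: y]).
by rewrite !IH ?addr0 // => b hs hc; apply: hw; rewrite /= ?hs ?hc.
Qed.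

Lemma matching_form_cycle l : matching_form l (matching_cycle l) 0%MM = 1.
Proof.
elim: l => [|[x y] l IH] /=.
  by rewrite has_nseq andbF mxE mcoeff1 eqxx.
by rewrite (matching_form0 l) add0r (matching_formX l x (matching_cycle l)).
Qed.

Lemma matching_cycle_homog l b : homog_of_degree (size l)%:Z (matching_cycle l b 0 0).
Proof.
elim: l b => [|[x y] l IH] b.
  rewrite /=; case: ifP => _; rewrite mxE; first exact: rpred0.
  exact: dhomog1.
case: b => [|[] [|[] b]]; rewrite /= ?mxE; try exact: rpred0.
have h : ('X_x : S) * matching_cycle l b 0 0 \is (1 + size l)%N.-homog; last exact: h.
by apply: dhomogM; [rewrite dhomogX /= mdeg1 | exact: (IH b)].
Qed.

Lemma koszul_d_matching_cycle l b : induced_matching l ->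
  I (koszul_d (vars (vs l)) (matching_cycle l) b 0 0).
Proof.
have [iI _] := edge_ideal_homog K e_irr.
have hE x y : e x y -> I ('X_x * 'X_y).
  move=> exy; apply/(edge_idealE _ e_irr); rewrite -mpolyXD; apply: supported_inX.
  by apply/adjacent_inP; exists x, y; rewrite mnm_setD !mnm_setU !inE !eqxx orbT.
have Z vs' (w : seq bool -> 'rV[S]_1) c : (forall c', w c' = 0) -> koszul_d (vars vs') w c = 0.
  by move=> hw; rewrite -[RHS](koszul_d0 'rV[S]_1 (vars vs') c); apply: eq_koszul_d => *; rewrite hw.
elim: l b => [|[x y] l IH] b /=.
  move=> _; suff -> : koszul_d (vars others) (matching_cycle [::]) b = 0 by rewrite mxE; exact: ideal0.
  elim: others b => [|i o IHo] [|[] b] //=; first by rewrite Z // oppr0.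
  by rewrite scaler0 addr0 -[RHS](IHo b); apply: eq_koszul_d.
move=> /and3P[exy _ ml].
have I0 : I ((0 : 'rV[S]_1) 0 0) by rewrite mxE; exact: ideal0.
case: b => [|[] [|[] b]]; rewrite /= ?koszul_d0 ?scaler0 ?addr0 ?add0r ?oppr0 //.
  rewrite (koszul_dZ _ _ (matching_cycle l)) !mxE.
  by apply: idealN => //; apply: idealMl => //; exact: IH.
rewrite scalerA mxE mulrC [X in _ * X]mulrC; apply: (idealMl iI); exact: hE.
Qed.

End InducedMatching.

Lemma induced_matching_regularity (K : fieldType) n (e : rel 'I_n) l (r : int) :
  ssrbool.symmetric e -> irreflexive e -> induced_matching e l ->
  is_regularity (edge_ideal K e) r -> (size l)%:Z <= r.
Proof.
move=> e_sym e_irr ml [F [_ _ Fr]]; rewrite leNgt; apply/negP => lt.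
pose o := [seq i <- enum 'I_n | i \notin vertices l].
pose vs := vertices l ++ o.
have uvs : uniq vs.
  rewrite cat_uniq (induced_matching_uniq e_sym e_irr ml) filter_uniq ?enum_uniq // andbT.
  by apply/hasPn => i; rewrite mem_filter => /andP[].
have vsT i : i \in vs by rewrite mem_cat mem_filter mem_enum andbT orbN.
have hI := edge_ideal_homog K e_irr.
have F_le i (k : 'I_(fr_rank F i)) : fr_deg k - i%:Z <= r.
  apply: Fr; rewrite /betti -lt0n card_gt0; apply/set0Pn; exists k; by rewrite inE.
(* With [m = size l], the cycle has homological degree [m] and coefficients of degree [m], hence
   degree [2m]; [r < m] puts it in the vanishing range [m + r < 2m]. *)
have [|||h hh] := koszul_homology_vanishing hI F_le uvs vsT (p := size l)
    (w := matching_cycle K l) (c := (size l).*2%:Z).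
- move=> b _; rewrite (_ : _ - _ = (size l)%:Z); first exact: matching_cycle_homog.
  lia.
- by move=> b p' _ _; exact: koszul_d_matching_cycle.
- lia.
have ind0 : ~~ adjacent_in e (mnm_set 0%MM : {set 'I_n}).
  by apply/adjacent_inP => -[i [j []]]; rewrite inE mnm0E.
have := matching_form_ideal e_sym e_irr (others := o) (l := l)
  (w := fun b => matching_cycle K l b - koszul_d [seq 'X_i | i <- vs] h b) (m := 0%MM) ml ind0.
rewrite (matching_formB o l (matching_cycle K l)) matching_form_cycle matching_form_koszul_d //; last first.
  by move=> i _; rewrite mnm0E.
move=> H; suff /eqP : (1 - 0 : K) = 0 by rewrite subr0 oner_eq0.
apply: H => [u v|b hs hc]; first by rewrite inE mnm0E.
exact: hh.
Qed.

(** * Leaves and induced matchings *)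

Section Combinatorics.
Variables (K : fieldType) (n : nat) (e : rel 'I_n).
Hypotheses (e_sym : ssrbool.symmetric e) (e_irr : irreflexive e).
Hypothesis e_scm : sequentially_CM (edge_ideal K e).
Variable color : 'I_n -> bool.
Hypothesis colorP : forall i j, e i j -> color i != color j.
Implicit Types (A W : {set 'I_n}).

Definition remainder A := ~: (A :|: neighbors e A).

Lemma remainderP A v : reflect (v \notin A /\ forall a, a \in A -> ~~ e a v) (v \in remainder A).
Proof.
rewrite inE in_setU negb_or; apply: (iffP andP) => -[hA h]; split=> //.
  by move=> a ha; apply: contraNN h => h; apply/neighborsP; exists a.
by apply/neighborsP => -[a /h /negP].
Qed.

Lemma not_adjacentP A : reflect (forall i j, i \in A -> j \in A -> ~~ e i j) (~~ adjacent_in e A).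
Proof.
apply: (iffP idP) => [h i j hi hj|h].
  by apply: contraNN h => h; apply/adjacent_inP; exists i, j.
by apply/adjacent_inP => -[i [j [hi hj]]]; apply/negP/h.
Qed.

(** A vertex given by [scm_face_connected] has at most one neighbour in the remainder, and at least
    one because no vertex there is isolated. The colouring is an argument so that the classes can be
    exchanged to meet the inequality. *)
Lemma bipartite_scm_leaf_aux (col : 'I_n -> bool) A : (forall i j, e i j -> col i != col j) ->
  ~~ adjacent_in e A ->
  (forall v, v \in remainder A -> exists2 u, u \in remainder A & e v u) ->
  remainder A != set0 ->
  (#|[set v in remainder A | col v]| <= #|[set v in remainder A | ~~ col v]|)%N ->
  exists x y, [/\ x \in remainder A, y \in remainder A, e x y &
    forall z, z \in remainder A -> e x z -> z = y].
Proof.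
move=> colP indA noiso /set0Pn[v0 hv0] le.
have mono b : ~~ adjacent_in e (A :|: [set v in remainder A | col v == b]).
  apply/not_adjacentP => i j; rewrite !inE.
  have hA u v : u \in A -> (v \notin A :|: neighbors e A) -> ~~ e u v.
    by move=> hu; apply: contraNN => h; rewrite inE; apply/orP; right; apply/neighborsP; exists u.
  move=> /orP[hi|/andP[hi /eqP ci]] /orP[hj|/andP[hj /eqP cj]].
  - by move/not_adjacentP: indA; apply.
  - by apply: hA => //; move: hj; rewrite !inE.
  - by rewrite e_sym; apply: hA => //; move: hi; rewrite !inE.
  - by apply/negP => /colP; rewrite ci cj eqxx.
have [u0 hu0 e0] := noiso _ hv0.
have [|||||y] := @scm_face_connected K n e A [set v in remainder A | col v]
  [set v in remainder A | ~~ col v] e_irr e_scm _ _ _ _ _ le.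
- by have := mono true; congr (~~ adjacent_in e (_ :|: _)); apply/setP => v; rewrite !inE eqb_id.
- by have := mono false; congr (~~ adjacent_in e (_ :|: _)); apply/setP => v; rewrite !inE eqbF_neg.
- by rewrite disjoints_subset; apply/subsetP => v; rewrite !inE => /andP[-> ->].
- by apply/setP => v; rewrite !inE; case: (col v); rewrite ?andbT ?andbF ?orbF.
- apply/set0Pn; case E : (col v0); last by exists v0; rewrite inE hv0 E.
  by exists u0; rewrite inE hu0; have := colP _ _ e0; rewrite E; case: (col u0).
rewrite inE => /andP[hy cy] card1; have [z hz eyz] := noiso _ hy.
have mem u : u \in remainder A -> e y u ->
    u \in [set v in remainder A | col v] :&: neighbors e [set y].
  move=> hu eyu; rewrite inE; apply/andP; split.
    by rewrite inE hu; have := colP _ _ eyu; move: cy; case: (col y); case: (col u).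
  by apply/neighborsP; exists y; rewrite // inE.
exists y, z; split=> // u hu eyu.
by apply: (card_le1_eqP card1); exact: mem.
Qed.

(** The isolated vertices of the remainder are first moved into [A]: this keeps [A] independent and
    takes no other vertex out of the remainder. *)
Lemma bipartite_scm_leaf A : ~~ adjacent_in e A -> adjacent_in e (remainder A) ->
  exists x y, [/\ x \in remainder A, y \in remainder A, e x y &
    forall z, z \in remainder A -> e x z -> z = y].
Proof.
move=> indA adjW.
pose iso := [set v in remainder A | ~~ [exists u in remainder A, e v u]].
have isoP v : reflect (v \in remainder A /\ forall u, u \in remainder A -> ~~ e v u) (v \in iso).
  rewrite [v \in iso]inE negb_exists_in; apply: (iffP andP) => -[h1 h2]; split=> //.
    by move=> u hu; exact: (forall_inP h2).
  exact/forall_inP.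
have indA' : ~~ adjacent_in e (A :|: iso).
  apply/not_adjacentP => i j; rewrite [i \in _]inE [j \in _]inE.
  move=> /orP[hi|/isoP[hi hi']] /orP[hj|/isoP[hj hj']].
  - by move/not_adjacentP: indA; apply.
  - by case/remainderP: hj => _; apply.
  - by rewrite e_sym; case/remainderP: hi => _; apply.
  - exact: hi'.
have remE v : (v \in remainder (A :|: iso)) = (v \in remainder A) && (v \notin iso).
  apply/remainderP/andP => [[h1 h2]|[h1 h2]].
    move: h1; rewrite inE negb_or => /andP[hA ->]; split=> //.
    by apply/remainderP; split=> // a ha; apply: h2; rewrite inE ha.
  have [hA hA'] := remainderP _ _ h1.
  rewrite inE negb_or hA; split=> // a; rewrite inE => /orP[/hA'//|/isoP[_]]; exact.
have [i [j [hi hj eij]]] := adjacent_inP _ _ adjW.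
have nb v u : v \in remainder A -> u \in remainder A -> e v u -> v \in remainder (A :|: iso).
  by move=> hv hu h; rewrite remE hv; apply/isoP => -[_ /(_ u hu)]; rewrite h.
have noiso v : v \in remainder (A :|: iso) -> exists2 u, u \in remainder (A :|: iso) & e v u.
  rewrite remE => /andP[hv]; rewrite [v \in iso]inE hv negbK => /exists_inP[u hu h].
  by exists u => //; apply: (nb u v) => //; rewrite e_sym.
have ne0 : remainder (A :|: iso) != set0 by apply/set0Pn; exists i; exact: (nb i j).
have [x [y [hx hy exy hxy]]] : exists x y, [/\ x \in remainder (A :|: iso), y \in remainder (A :|: iso),
    e x y & forall z, z \in remainder (A :|: iso) -> e x z -> z = y].
  have [le|/ltnW le] := leqP #|[set v in remainder (A :|: iso) | color v]|
     #|[set v in remainder (A :|: iso) | ~~ color v]|.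
    exact: (bipartite_scm_leaf_aux colorP).
  apply: (bipartite_scm_leaf_aux (col := fun v => ~~ color v)) => //.
    by move=> u v /colorP; case: (color u); case: (color v).
  rewrite (_ : [set v in _ | ~~ ~~ color v] = [set v in remainder (A :|: iso) | color v]) //.
  by apply: eq_finset => v; rewrite negbK.
have sub v : v \in remainder (A :|: iso) -> v \in remainder A by rewrite remE => /andP[].
exists x, y; split=> //; [exact: sub | exact: sub | move=> z hz exz].
by apply: hxy => //; apply: (nb z x) => //; [exact: sub | rewrite e_sym].
Qed.

Lemma exists_matching_cover : exists A l, [/\ ~~ adjacent_in e A, induced_matching e l,
  size l = #|A| & ~~ adjacent_in e (remainder A)].
Proof.
(* The invariant is that no edge joins a matched vertex to the remainder. For a leaf [x] with
   neighbour [y], adding [y] to [A] takes [y] and its neighbours out of the remainder, and [x] had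
   no other neighbour there. *)
suff main k : forall A l, ~~ adjacent_in e A -> induced_matching e l -> size l = #|A| ->
    (forall u v, u \in vertices l -> v \in remainder A -> ~~ e u v) -> (#|remainder A| <= k)%N ->
    exists A l, [/\ ~~ adjacent_in e A, induced_matching e l,
      size l = #|A| & ~~ adjacent_in e (remainder A)].
  apply: (main _ set0 [::]) (leqnn _) => //; last by rewrite cards0.
  by apply/not_adjacentP => i j; rewrite inE.
elim: k => [|k IH] A l indA ml sz hl hk;
  have [adj|nadj] := boolP (adjacent_in e (remainder A)); try by exists A, l.
  move: adj; rewrite leqn0 cards_eq0 in hk; rewrite (eqP hk) => /adjacent_inP[i [j []]].
  by rewrite inE.
have [x [y [hx hy exy hxy]]] := bipartite_scm_leaf indA adj.
have [yA yA'] := remainderP _ _ hy.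
have sub v : v \in remainder (y |: A) -> [/\ v \in remainder A, v != y & ~~ e y v].
  move=> /remainderP[hv h]; have /andP[vy vA] : (v != y) && (v \notin A).
    by move: hv; rewrite !inE negb_or.
  split=> //.
    by apply/remainderP; split=> // a ha; apply: h; rewrite !inE ha orbT.
  by apply: h; rewrite !inE eqxx.
apply: (IH (y |: A) ((x, y) :: l)).
- apply/not_adjacentP => i j; rewrite !inE => /orP[/eqP->|hi] /orP[/eqP->|hj].
  + by rewrite e_irr.
  + by rewrite e_sym; exact: yA'.
  + exact: yA'.
  + by move/not_adjacentP: indA; apply.
- rewrite /= exy ml andbT; apply/allP => v hv.
  by rewrite e_sym (hl _ _ hv hx) e_sym (hl _ _ hv hy).
- by rewrite cardsU1 yA /= sz.
- move=> u v hu /sub[hv vy eyv]; move: hu; rewrite /= !inE => /or3P[/eqP->|/eqP->|hu] //.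
    by apply: contraNN vy => /(hxy v hv) ->.
  exact: hl.
rewrite -ltnS; apply: leq_trans hk; apply: proper_card; apply/properP; split.
  by apply/subsetP => v /sub[].
by exists y => //; apply/negP => /sub[_]; rewrite eqxx.
Qed.

(** The complement of [N(A)] consists of [A] and the remainder, hence is independent: a term of [g]
    supported there stays outside the edge ideal after multiplication by [t_A]. A variable from
    [N(A)], on the other hand, forms an edge with [A]. *)
Lemma cover_v_witness A : ~~ adjacent_in e A -> ~~ adjacent_in e (remainder A) ->
  v_witness (edge_ideal K e) #|A|.
Proof.
move=> indA indW; pose p := @face_prime K n (~: neighbors e A).
have E : ideal_eq (colon (edge_ideal K e) (monomial_of K A)) p.
  move=> g; split=> [/(edge_idealE _ e_irr) h m|h].
    rewrite negbK => /subsetP hm; rewrite -(mcoeffMX g (set_mnm A)); apply: h.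
    rewrite mnm_setD set_mnmK; apply/not_adjacentP => i j.
    have AB u v : u \in A -> v \in mnm_set m -> ~~ e u v.
      by move=> hu /hm; rewrite inE; apply: contraNN => h; apply/neighborsP; exists u.
    rewrite !in_setU => /orP[hi|hi] /orP[hj|hj].
    - by move/not_adjacentP: indA; apply.
    - exact: AB.
    - by rewrite e_sym; exact: AB.
    have [iA|iA] := boolP (i \in A); first exact: AB.
    have [jA|jA] := boolP (j \in A); first by rewrite e_sym; exact: AB.
    move/not_adjacentP: indW; apply; apply/remainderP; split=> // a ha; exact: AB.
  apply/(edge_idealE _ e_irr).
  apply: (supported_inM (Q := fun B => B == A)) h _; last first.
    by apply: supported_inX; rewrite set_mnmK.
  move=> B C /subsetPn[j jB]; rewrite inE negbK => /neighborsP[i iA eij] /eqP ->.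
  by apply/adjacent_inP; exists i, j; rewrite !inE iA jB orbT.
exists (monomial_of K A), p; split=> //.
  rewrite dhomogX /= mdegE; apply/eqP; rewrite -sum1_card [RHS]big_mkcond /=.
  by apply: eq_bigr => i _; rewrite mnmE; case: (i \in A).
by split; [exact: face_prime_prime | exists (monomial_of K A)].
Qed.
End Combinatorics.

Theorem corollary3p16 (K : fieldType) (s : nat) (e : rel 'I_s)
    (e_sym : ssrbool.symmetric e) (e_irr : irreflexive e)
    (e_bip : bipartite e)
    (e_scm : sequentially_CM (edge_ideal K e))
    (v : nat) (r : int)
    (hv : is_v_number (edge_ideal K e) v)
    (hr : is_regularity (edge_ideal K e) r) :
  (v%:Z <= r)%R.
Proof.
have [color colorP] := e_bip.
have [A [l [indA ml sz indW]]] := exists_matching_cover e_sym e_irr e_scm colorP.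
apply: le_trans (induced_matching_regularity e_sym e_irr ml hr).
by rewrite lez_nat sz; have [_] := hv; apply; exact: cover_v_witness.
Qed.
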